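(* Let $p\colon[0,1]\to[1,\infty)$ be a measurable function and let $\pi\colon[0,1]\to[0,1]$ be a measure-preserving transform. Suppose that $f\in L^{p(\cdot)}_{\mathrm{ODE}}[0,1]$ and $f\circ\pi^{-1}\in L^{p\circ\pi^{-1}}_{\mathrm{ODE}}[0,1]$. Then $$\frac1{b_{\overline p}}\|f\|_{p(\cdot)}\le\|f\circ\pi^{-1}\|_{p\circ\pi^{-1}}\le b_{\overline p}\|f\|_{p(\cdot)}.$$ Moreover, if $\pi_1,\pi_2\colon[0,1]\to[0,1]$ are measure-preserving transforms with $f\circ\pi_i^{-1}\in L^{p\circ\pi_i^{-1}}_{\mathrm{ODE}}[0,1]$ ($i=1,2$), chosen such that $p\circ\pi_1^{-1}$ is an increasing rearrangement of $p$ and $p\circ\pi_2^{-1}$ is a decreasing rearrangement of $p$, then $$\|f\circ\pi_1^{-1}\|_{p\circ\pi_1^{-1}}\le\|f\|_{p(\cdot)}\le\|f\circ\pi_2^{-1}\|_{p\circ\pi_2^{-1}}.$$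
   Context: A measure-preserving transform is a bijection $\pi\colon[0,1]\to[0,1]$ such that for each Lebesgue measurable $E\subset[0,1]$ the preimage $\pi^{-1}(E)$ is Lebesgue measurable and $m(\pi^{-1}(E))=m(E)$, $m$ being Lebesgue measure. Increasing and decreasing are meant in the non-strict sense. $\overline p=\operatorname{ess\,sup}p$ (with $\overline p=\infty$ if $p$ is essentially unbounded). Constants: $b_1=1$, $b_\infty=2$, and for $1<q<\infty$, $b_q$ is the unique solution $b\in(1,2)$ of $b+b^{-q}=2$. ODE-determined norm: given measurable $p\colon[0,1]\to[1,\infty)$ and measurable $f\colon[0,1]\to\mathbb R$, for $x_0>0$ let $\varphi_{x_0,f}$ be the (unique, if it exists) absolutely continuous non-decreasing function on $[0,1]$ with $\varphi(0)=x_0$ and $\varphi'(t)=\frac{|f(t)|^{p(t)}}{p(t)}\varphi(t)^{1-p(t)}$ for a.e. $t\in[0,1]$. If these exist for all $x_0>0$, let $\varphi_f(t)=\lim_{x_0\searrow0}\varphi_{x_0,f}(t)$. We say $\varphi_f$ exists if this limit is an absolutely continuous, non-decreasing function with $\varphi_f(0)=0$ satisfying the same differential equation a.e. (the right-hand side read as $0$ where $f(t)=0$). $L^{p(\cdot)}_{\mathrm{ODE}}[0,1]$ is the set of measurable $f$ for which $\varphi_f$ exists, and $\|f\|_{p(\cdot)}:=\varphi_f(1)$ (this notation is used whether or not the class is a linear space). *)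

(* Defs.v *)
From HB Require Import structures.
From mathcomp Require Import all_boot all_order all_algebra.
From mathcomp Require Import all_classical all_reals all_analysis.
From mathcomp Require Import ess_sup_inf.

Set Implicit Arguments.
Unset Strict Implicit.
Unset Printing Implicit Defensive.

Import Order.TTheory GRing.Theory Num.Theory.
Import numFieldNormedType.Exports.

Local Open Scope classical_set_scope.
Local Open Scope ring_scope.

(* Functions on [0,1] are total functions R -> R of which only the values on
   `[0, 1] matter. *)

(* [R] with its Lebesgue (Caratheodory, i.e. completed Borel) sigma-algebra, the
   domain of [completed_lebesgue_measure]; the canonical structure on [R]
   itself is the Borel one. *)
Notation lebesgueType R := (caratheodory_type (wlength (@idfun R))^*%mu).

Section definitions.
Context {R : realType}.

Local Notation mu := (@lebesgue_measure R).
Local Notation I := (`[0, 1]%classic : set R).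

Definition lebesgue_measurable (E : set R) : Prop :=
  measurable (E : set (lebesgueType R)).

Definition lebesgue_measurable_fun (f : R -> R) : Prop :=
  measurable_fun (I : set (lebesgueType R)) (f : lebesgueType R -> R).

Definition measure_preserving_transform (pi : R -> R) : Prop :=
  set_bij I I pi /\
  forall E : set R, E `<=` I -> lebesgue_measurable E ->
    lebesgue_measurable (I `&` pi @^-1` E) /\
    completed_lebesgue_measure (I `&` pi @^-1` E) =
    completed_lebesgue_measure E.

(* The inverse of a bijection of [0,1]. *)
Definition inv01 (pi : R -> R) : R -> R := pinv I pi.

Definition abs_continuous (phi : R -> R) : Prop :=
  forall e : R, 0 < e -> exists2 d : R, 0 < d &
    forall (n : nat) (a b : 'I_n -> R),
      (forall i, [/\ 0 <= a i, a i <= b i & b i <= 1]) ->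
      trivIset [set: 'I_n] (fun i => `]a i, b i[%classic) ->
      \sum_(i < n) (b i - a i) < d ->
      \sum_(i < n) `|phi (b i) - phi (a i)| < e.

(* [powR] sends 0 to 0 for every nonzero exponent, so the value +oo of
   0 `^ (1 - p t) for p t > 1 has to be given explicitly; no derivative
   can equal it.  For p t = 1 one has 0 `^ 0 = 1. *)
Definition ode_rhs (p f phi : R -> R) (t : R) : \bar R :=
  if f t == 0 then 0%E
  else if (phi t == 0) && (1 < p t) then +oo%E
  else (`|f t| `^ p t / p t * phi t `^ (1 - p t))%:E.

(* The almost-everywhere quantifier of [lebesgue_measure] is insensitive to
   completion: its negligible sets are all the Lebesgue null sets. *)
Definition ode_solution (p f : R -> R) (x0 : R) (phi : R -> R) : Prop :=
  [/\ abs_continuous phi,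
      {in I &, {homo phi : s t / s <= t}},
      phi 0 = x0 &
      {ae mu, forall t, I t ->
         derivable phi t 1 /\ (phi^`()%classic t)%:E = ode_rhs p f phi t}].

(* Meaningful only if a solution exists; its values on [0,1] are then unique,
   as the right-hand side is nonincreasing in phi. *)
Definition ode_phi (p f : R -> R) (x0 : R) : R -> R :=
  xget (cst 0) [set phi | ode_solution p f x0 phi].

Definition ode_phi0 (p f : R -> R) (t : R) : R :=
  lim (ode_phi p f x0 t @[x0 --> 0^'+]).

Definition L_ODE (p : R -> R) : set (R -> R) :=
  [set f | [/\ lebesgue_measurable_fun f,
    forall x0, 0 < x0 -> exists phi, ode_solution p f x0 phi,
    forall t, I t -> cvg (ode_phi p f x0 t @[x0 --> 0^'+]) &
    ode_solution p f 0 (ode_phi0 p f)]].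

Definition ode_norm (p f : R -> R) : R := ode_phi0 p f 1.

(* The value -oo outside [0,1] restricts the essential supremum to [0,1]. *)
Definition ess_sup01 (p : R -> R) : \bar R :=
  ess_sup mu (patch (cst -oo%E) I (EFin \o p)).

(* Only meaningful for 1 <= q <= +oo. *)
Definition b_const (q : \bar R) : R :=
  match q with
  | r%:E => if r == 1 then 1
            else xget 0 [set b | 1 < b < 2 /\ b + b `^ (- r) = 2]
  | +oo%E => 2
  | -oo%E => 0
  end.

End definitions.

(* Main.v *)
Require Import Defs.
From mathcomp Require Import all_boot all_order all_algebra.
From mathcomp Require Import all_classical all_reals all_analysis.
From mathcomp Require Import measurable_realfun ess_sup_inf.
From mathcomp Require Import ring lra.

(* Fix x0 > 0 and let phi solve the equation with phi(0) = x0.  For an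
   arrangement (p, f) and a positive function m put
   k = |f|^p / p * c^(1 - p) * m(c), where the reference value c > 0 may depend
   on the point.  If c^(1 - p) m(c) <= phi^(1 - p) m(phi) pointwise then
   k <= (G o phi)' with G' = m, and dually; since the integral of k is invariant
   under measure-preserving rearrangements, bounds for two arrangements can be
   compared.

   - Bounds with b: take c = N = phi(1).  With m = 1 this gives
     int k <= N - x0.  Let phi2 solve the equation for the rearranged data and
     let t0 be the time where phi2 = N.  After t0, int k2 >= phi2(1) - N; before
     t0, if p <= q, the choice m(u) = (u / N)^(q - 1) gives
     int k2 >= N / q - x0 / q.  Hence phi2(1) <= (2 - 1/q) N, and
     2 - 1/q <= b_q.

   - Monotone exponents: take c = phi1, the solution of the sorted arrangement,
     evaluated at the corresponding point.  When p1 is increasing, p1 - 1 is a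
     subgradient at ln phi1 of a convex function M, and for m = exp (M o ln) the
     map u |-> u^(1 - p1) m(u) is minimal at u = phi1.  When p1 is decreasing,
     m = exp (- M o ln) makes phi1 a maximum.

   The rearrangement of k stays measurable because, by Lusin's theorem, the
   inverse of a measure-preserving transform is again one. *)

Import Order.TTheory GRing.Theory Num.Theory.
Import numFieldNormedType.Exports.
Local Open Scope classical_set_scope.
Local Open Scope ring_scope.
Set Implicit Arguments.
Unset Strict Implicit.
Unset Printing Implicit Defensive.

(** * Monotonicity of absolutely continuous functions with a.e. nonnegative derivative *)

Section AbsCont.
Context {R : realType}.
Local Notation mu := (@lebesgue_measure R).
Implicit Types (F G : R -> R) (a b c t : R).

Lemma derive1_near F t (e : R) : derivable F t 1 -> 0 < e ->
  \forall z \near t, `|F z - F t - derive1 F t * (z - t)| <= e * `|z - t|.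
Proof.
move=> dF e0.
have cF : h^-1 *: (F (h + t) - F t) @[h --> 0^'] --> derive1 F t.
  rewrite /derive1; apply/cvg_ex; exists (derive1 F t).
  rewrite derive1E; apply: cvg_trans dF.
  apply: near_eq_cvg; near=> h => /=; by rewrite [h%:A]mulr1.
move/cvgrPdist_le : cF => /(_ e e0).
rewrite near_withinE => He.
have : \forall z \near t, (z - t != 0 ->
   `|derive1 F t - (z - t)^-1 *: (F (z - t + t) - F t)| <= e).
  have ct : (fun z => z - t) @ t --> (0:R).
    rewrite -[X in _ --> X](subrr t); apply: cvgB; [exact: cvg_id|exact: cvg_cst].
  by have := ct _ He.
apply: filterS => z.
have [->|] := eqVneq z t; first by rewrite !subrr mulr0 subrr normr0 mulr0.
rewrite -subr_eq0 => zt /(_ zt); rewrite subrK => H.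
have -> : F z - F t - derive1 F t * (z - t) = - ((derive1 F t - (z - t)^-1 *: (F z - F t)) * (z - t)).
  rewrite /GRing.scale /=. field. exact: zt.
by rewrite normrN normrM ler_pM2r ?normr_gt0.
Unshelve. all: by end_near. Qed.

Lemma derive1_ge0_near F t (e : R) : derivable F t 1 -> 0 <= derive1 F t ->
  0 < e -> exists2 d : R, 0 < d & forall z,
    (t <= z < t + d -> F z - F t >= - e * (z - t)) /\
    (t - d < z <= t -> F t - F z >= - e * (t - z)).
Proof.
move=> dF F0 e0; have := derive1_near dF e0.
move=> /nbhs_ballP[d /= d0 Hd]; exists d => // z; split => /andP[z1 z2].
  have /Hd : ball t d z by rewrite /ball /= distrC ger0_norm; lra.
  rewrite /= [`|z - t|]ger0_norm ?subr_ge0// ler_norml => /andP[+ _].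
  have : 0 <= derive1 F t * (z - t) by rewrite mulr_ge0// subr_ge0.
  lra.
have /Hd : ball t d z by rewrite /ball /= ger0_norm; lra.
rewrite /= [`|z - t|]ler0_norm ?subr_le0// ler_norml => /andP[_].
have : 0 <= derive1 F t * (t - z) by rewrite mulr_ge0// subr_ge0.
lra.
Qed.

Definition chain (U : set R) (P : R -> R -> Prop) a s :=
  exists n (x : nat -> R), [/\ x 0%N = a, x n = s &
    forall i, (i < n)%N -> x i <= x i.+1 /\
      (`]x i, x i.+1[%classic `<=` U \/ P (x i) (x i.+1))].

Lemma chain0 U P a : chain U P a a.
Proof. by exists 0%N, (cst a); split. Qed.

Lemma chain_step U P a s z : chain U P a s -> s <= z ->
  (`]s, z[%classic `<=` U \/ P s z) -> chain U P a z.
Proof.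
move=> [n [x [x0 xn Hx]]] sz Hsz.
exists n.+1, (fun i => if (i <= n)%N then x i else z); split => //.
  by rewrite ltnn.
move=> i; rewrite ltnS leq_eqVlt => /orP[/eqP->|ni] /=.
  by rewrite eqxx ltnn xn.
by rewrite ni orbT; exact: Hx.
Qed.

(** Real induction: the supremum [s] of the points reached from [a] is itself reached, by the
    left-hand local condition at [s]; if [s < b], the right-hand condition reaches a point beyond
    [s], a contradiction. *)
Lemma chain_exists (U : set R) (P : R -> R -> Prop) a b : a <= b ->
  (forall t, a <= t <= b -> exists2 d : R, 0 < d & 
     (forall z, t <= z < t + d -> z <= b -> `]t, z[%classic `<=` U \/ P t z) /\
     (forall z, t - d < z <= t -> a <= z -> `]z, t[%classic `<=` U \/ P z t)) ->
  chain U P a b.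
Proof.
move=> ab H.
pose S := [set s | a <= s <= b /\ chain U P a s].
have Sa : S a by split; [lra|exact: chain0].
have ubS : has_ubound S by exists b => s [/andP[]].
have supS : has_sup S by split => //; exists a.
pose s := sup S.
have as_ : a <= s by apply: ub_le_sup.
have sb : s <= b by apply: ge_sup; [exists a|move=> x [/andP[]]].
have [d d0 [Hr Hl]] := H s (introT andP (conj as_ sb)).
have [y [[/andP[ay yb] cy]]] := sup_adherent d0 supS.
rewrite -/s => sdy.
have ys : y <= s by apply: ub_le_sup => //; split => //; rewrite ay.
have cs : chain U P a s.
  by apply: (chain_step cy) => //; apply: Hl => //; rewrite sdy.
have [bs|sltb] := leP b s; first by have -> : b = s by lra.
pose z := Num.min b (s + d / 2).
have zb : z <= b by rewrite ge_min lexx.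
have sz : s < z by rewrite lt_min; lra.
have zs : z <= s + d / 2 by rewrite ge_min lexx orbT.
have : S z.
  split; first lra.
  apply: (chain_step cs); [lra|apply: Hr => //; lra].
move=> /(ub_le_sup ubS); rewrite -/s; lra.
Qed.

Lemma chain_mono (n : nat) (x : nat -> R) :
  (forall i, (i < n)%N -> x i <= x i.+1) ->
  forall i j, (i <= j)%N -> (j <= n)%N -> x i <= x j.
Proof.
move=> H i j ij; elim: j ij => [|j IH]; first by rewrite leqn0 => /eqP->.
rewrite leq_eqVlt => /orP[/eqP->//|]; rewrite ltnS => /IH{}IH jn.
by rewrite (le_trans (IH (ltnW jn)))// H.
Qed.

(** Turns the total length occurring in absolute continuity into a measure. Intervals with
    [l i = r i] are empty and count 0 on both sides. *)
Lemma sum_itv_measure n (l r : 'I_n -> R) : (forall i, l i <= r i) ->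
  trivIset [set: 'I_n] (fun i => `]l i, r i[%classic) ->
  ((\sum_(i < n) (r i - l i))%:E = mu (\big[setU/set0]_(i < n) `]l i, r i[%classic))%E.
Proof.
move=> lr tI; rewrite measure_bigsetU_ord//= -sumEFin; apply: eq_bigr => i _.
rewrite lebesgue_measure_itv/= lte_fin; case: ltP => // rl.
by have -> : r i = l i; [apply/le_anti; rewrite lr rl|rewrite subrr].
Qed.

(* Real induction along [a, b]: a good point is passed by differentiability; the
   null set of bad points is covered by an open U of small measure, and absolute
   continuity bounds the total variation of F over the steps inside U. *)
Lemma ac_ae_derive_ge0_le F a b : abs_continuous F -> 0 <= a -> a <= b -> b <= 1 ->
  {ae mu, forall t, a <= t <= b -> derivable F t 1 /\ 0 <= derive1 F t} ->
  F a <= F b.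
Proof.
move=> acF a0 ab b1 [N [mN N0 NF]].
apply/ler_addgt0Pr => e e0; rewrite -lerBlDr.
have e20 : 0 < e / 2 by lra.
have [d d0 Hd] := acF _ e20.
have [U [oU NU UN]] : exists U : set R, [/\ open U, N `<=` U & (mu (U `\` N) < d%:E)%E].
  apply: lebesgue_regularity_outer => //.
  have /le_lt_trans : (mu N <= 0)%E by rewrite N0.
  by apply; rewrite ltry.
have mU : measurable U by exact: open_measurable.
have Ud : (mu U < d%:E)%E.
  rewrite -(setDUK NU) setUC measureU0//; exact: measurableD.
have [n [x [xa xb Hx]]] : chain U (fun s z => F z - F s >= - (e/2) * (z - s)) a b.
  apply: chain_exists => // t tab.
  have [Nt|nNt] := pselect (N t).
    have /nbhs_ballP[r /= r0 Ur] : nbhs t U by apply: open_nbhs_nbhs; split => //; exact: NU.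
    exists r => //; split => z /andP[z1 z2] _; left => y;
      rewrite /= in_itv/= => /andP[y1 y2]; apply: Ur; rewrite /ball /=.
      by rewrite distrC ger0_norm; lra.
    by rewrite ger0_norm; lra.
  have [dF F0] : derivable F t 1 /\ 0 <= derive1 F t.
    apply: contrapT => h; apply: nNt; apply: NF => /= h'; exact: h (h' tab).
  have [r r0 Hr] := derive1_ge0_near dF F0 e20.
  exists r => //; split => z zz _; right; [exact: (Hr z).1|exact: (Hr z).2].
have xm := chain_mono (fun i ni => (Hx i ni).1).
pose good i := F (x i.+1) - F (x i) >= - (e/2) * (x i.+1 - x i).
(* Good steps are collapsed to empty intervals, so the family keeps its index type while only the
   bad steps, which lie in [U], contribute length and variation. *)
pose l (i : 'I_n) := x i; pose r (i : 'I_n) := if good i then x i else x i.+1.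
have lr i : [/\ 0 <= l i, l i <= r i & r i <= 1].
  have [in0 in1] : a <= x i /\ x i.+1 <= b.
    by rewrite -xa -xb; split; apply: xm => //; exact: ltnW.
  have xx := (Hx i (ltn_ord i)).1.
  rewrite /l /r; case: ifP => _; split; lra.
have tI : trivIset [set: 'I_n] (fun i => `]l i, r i[%classic).
  have key (i j : 'I_n) y : (i < j)%N -> l i < y < r i -> l j < y < r j -> False.
    move=> ij /andP[_ yr] /andP[ly _].
    have : r i <= x i.+1 by rewrite /r; case: ifP => // _; exact: (Hx i (ltn_ord i)).1.
    have : x i.+1 <= x j by apply: xm => //; exact: ltnW.
    by move: ly; rewrite /l; lra.
  apply/trivIsetP => i j _ _ ij; rewrite -subset0 => y /= [].
  rewrite !in_itv/= => yi yj.
  have : (i != j :> nat) by [].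
  by rewrite neq_ltn => /orP[/key|/key] => /(_ y); tauto.
have sum_lt : \sum_(i < n) (r i - l i) < d.
  rewrite -lte_fin; apply: le_lt_trans Ud.
  rewrite sum_itv_measure//; last by move=> i; case: (lr i).
  apply: le_measure; rewrite ?inE//; first exact: bigsetU_measurable.
  rewrite -bigcup_pred.
  move=> y [i _ /=]; rewrite in_itv/= /l /r.
  case: ifP => [_|/negP bi]; first by lra.
  case: (Hx i (ltn_ord i)) => _ [|//] => H yy; apply: H.
  by rewrite /= in_itv.
have := Hd n l r lr tI sum_lt.
set V := (X in X < _) => HV.
(* The good steps lose at most [e / 2] times their length, the bad ones at most their variation,
   which sums to [V < e / 2]. *)
have : F b - F a >= - (e/2) * (b - a) - V.
  rewrite -xa -xb -(telescope_sumr (fun i => F (x i)))// -(telescope_sumr x)//.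
  rewrite !big_mkord mulr_sumr -sumrB; apply: ler_sum => i _.
  rewrite /l /r; case: ifP => [gi|_].
    by rewrite subrr normr0 subr0.
  have := ler_norm (F (x i) - F (x i.+1)).
  have := (Hx i (ltn_ord i)).1.
  rewrite distrC; nra.
have : e / 2 * (b - a) <= e / 2 by nra.
lra.
Qed.

End AbsCont.

(** * Stability properties of absolute continuity and indefinite integrals *)

Section AbsContClosure.
Context {R : realType}.
Local Notation mu := (@lebesgue_measure R).
Implicit Types (F G : R -> R) (a b c t : R).

Lemma ac_sub F G : abs_continuous F -> abs_continuous G ->
  abs_continuous (fun t => F t - G t).
Proof.
move=> acF acG e e0; have e20 : 0 < e / 2 by lra.
have [d d0 Hd] := acF _ e20; have [d' d'0 Hd'] := acG _ e20.
exists (Num.min d d'); first by rewrite lt_min d0.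
move=> n a b ab tI; rewrite lt_min => /andP[s1 s2].
have := Hd n a b ab tI s1; have := Hd' n a b ab tI s2.
suff : \sum_(i < n) `|F (b i) - G (b i) - (F (a i) - G (a i))| <=
  \sum_(i < n) `|F (b i) - F (a i)| + \sum_(i < n) `|G (b i) - G (a i)| by lra.
rewrite -big_split /=; apply: ler_sum => i _.
have -> : F (b i) - G (b i) - (F (a i) - G (a i)) =
          (F (b i) - F (a i)) - (G (b i) - G (a i)) by ring.
exact: ler_normB.
Qed.

Lemma ac_lipschitz_comp F G (C : R) :
  (forall s t, 0 <= s <= 1 -> 0 <= t <= 1 ->
     `|G (F s) - G (F t)| <= C * `|F s - F t|) ->
  abs_continuous F -> abs_continuous (G \o F).
Proof.
(* [C] need not be positive, so it is replaced by a bound that can be divided by. *)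
move=> HC acF e e0; pose C1 := Num.max C 1.
have C10 : 0 < C1 by rewrite lt_max ltr01 orbT.
have [d d0 Hd] := acF (e / C1) (divr_gt0 e0 C10).
exists d => // n a b ab tI sd; have := Hd n a b ab tI sd.
rewrite ltr_pdivlMr// => /le_lt_trans; apply.
rewrite mulr_suml; apply: ler_sum => i _ /=.
have [a0 aib b1] := ab i.
apply: (le_trans (HC _ _ _ _)); [lra|lra|].
by rewrite mulrC ler_wpM2l// le_max lexx.
Qed.

Lemma ac_continuous F : abs_continuous F -> {within `[0, 1], continuous F}.
Proof.
move=> acF; apply/subspace_continuousP => t /=; rewrite in_itv/= => t01.
apply/cvgrPdist_lt => e e0; have [d d0 Hd] := acF e e0.
rewrite near_withinE; apply/nbhs_ballP; exists d => // z /= tz; rewrite in_itv/= => z01.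
have := Hd 1%N (fun=> Num.min t z) (fun=> Num.max t z).
rewrite !big_ord1 => H.
have : `|F (Num.max t z) - F (Num.min t z)| < e.
  apply: H.
  - move=> _; split; [rewrite le_min; lra|by rewrite ge_min le_max lexx|rewrite ge_max; lra].
  - by apply/trivIsetP => i j; rewrite !ord1 eqxx.
  - by rewrite maxr_absE minr_absE; move: tz; rewrite /ball /=; lra.
by case: (leP t z) => // _; rewrite distrC.
Qed.

(** The increments over disjoint intervals are bounded by the integral of [|k|] over their union,
    which is small when the measure of the union is. *)
Lemma ac_integral (k : R -> R) : mu.-integrable setT (EFin \o k) ->
  abs_continuous (fun x => (\int[mu]_(t in `]-oo, x]) k t)%R).
Proof.
move=> ik e e0; have [d [d0 Hd]] := integral_normr_continuous ik e0.
exists d => // n a b ab tI sd.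
have lab i : a i <= b i by case: (ab i).
pose A := \big[setU/set0]_(i < n) `]a i, b i[%classic.
have mA : measurable A by exact: bigsetU_measurable.
have /(Hd _ mA) : (mu A < d%:E)%E by rewrite -sum_itv_measure// lte_fin.
have iD (D : set R) : measurable D -> mu.-integrable D (EFin \o k).
  by move=> mD; apply: integrableS ik.
have inD (D : set R) : measurable D -> mu.-integrable D (EFin \o (fun t => `|k t|)).
  by move=> mD; exact: integrable_norm (iD D mD).
have <- : \sum_(i < n) (\int[mu]_(t in `]a i, b i[) `|k t|)%R = (\int[mu]_(x in A) `|k x|)%R.
  rewrite /Rintegral [in RHS]integral_bigsetU_EFin//=.
  - rewrite sum_fine// => i _; apply: integrable_fin_num => //; exact: inD.
  - by rewrite /index_enum -enumT enum_uniq.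
  - by apply: sub_trivIset tI.
  - by apply: measurable_int (inD A mA).
apply: le_lt_trans; apply: ler_sum => i _; rewrite Rintegral_itvB ?bnd_simp//; last exact: iD.
apply: le_trans (le_normr_Rintegral _ (iD _ _)) _ => //.
rewrite le_eqVlt; apply/orP; left; apply/eqP/esym.
by rewrite Rintegral_itv_bndo_bndc//; exact: inD.
Qed.

End AbsContClosure.

(** * Passing between Lebesgue and Borel measurability *)

Section Completion.
Context {R : realType}.
Local Notation mu := (@lebesgue_measure R).
Local Notation cmu := (@completed_lebesgue_measure R).

Lemma borel_lebesgue_measurable (A : set R) :
  measurable A -> lebesgue_measurable A.
Proof. by move=> mA; exact: sub_caratheodory. Qed.

Lemma completed_lebesgue_measureE (A : set R) : cmu A = mu A.
Proof. by []. Qed.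

Lemma lebesgue_measurable_borel (E : set R) : lebesgue_measurable E ->
  exists N : set R, [/\ measurable N, mu N = 0%E & measurable (E `\` N)].
Proof.
rewrite /lebesgue_measurable -completed_caratheodory_measurable.
rewrite g_sigma_completed_algebra_genE => -[A mA [Z [N [mN N0 ZN]]] <-].
exists N; split => //.
have -> : (A `|` Z) `\` N = A `\` N.
  rewrite setDUl; apply/seteqP; split => [x [//|[/ZN Nx nNx]]|x]; [by []|by left].
exact: measurableD.
Qed.

Lemma null_lebesgue_measurable (N E : set R) : measurable N -> mu N = 0%E ->
  E `<=` N -> lebesgue_measurable E.
Proof.
move=> mN N0 EN; apply: completed_lebesgue_measure_is_complete.
by exists N; split => //; exact: borel_lebesgue_measurable.
Qed.

(** Each superlevel set of rational level is Borel off a null set; the union of these countably many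
    null sets serves for all levels. *)
Lemma lebesgue_measurable_fun_borel (k : R -> R) :
  measurable_fun (setT : set (lebesgueType R)) (k : lebesgueType R -> R) ->
  exists N : set R, [/\ measurable N, mu N = 0%E & measurable_fun (~` N) k].
Proof.
move=> mk.
have H (q : rat) : exists N : set R, [/\ measurable N, mu N = 0%E &
    measurable ((k @^-1` `]ratr q, +oo[) `\` N)].
  apply: lebesgue_measurable_borel; rewrite /lebesgue_measurable -[X in measurable X]setTI.
  exact: mk.
pose Z q := sval (cid (H q)).
have HZ q : [/\ measurable (Z q), mu (Z q) = 0%E &
    measurable ((k @^-1` `]ratr q, +oo[) `\` Z q)] := svalP (cid (H q)).
pose N := \bigcup_q Z q.
have mN : measurable N.
  by apply: bigcupT_measurable_rat => q; case: (HZ q).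
exists N; split => //.
  apply: measure_negligible => //.
  have -> : N = \bigcup_n (if (unpickle n : option rat) is Some q then Z q else set0).
    apply/seteqP; split => [x [q _ Zx]|x [n _]].
      by exists (pickle q); [exact: I|rewrite pickleK].
    by case: (unpickle n) => // q Zx; exists q.
  apply: negligible_bigcup => n; case: (unpickle n) => [q|].
    by case: (HZ q) => mZ Z0 _; exact/negligibleP.
  exact: negligible_set0.
apply: (measurability _ (RGenOInfty.measurableE R)) => //.
move=> _ [_ [r ->] <-].
(* A real level is recovered from the rational levels above it. *)
have -> : ~` N `&` k @^-1` `]r, +oo[ =
    \bigcup_q (if r < ratr q then ((k @^-1` `]ratr q, +oo[) `\` Z q) `\` N else set0).
  apply/seteqP; split => [x [nNx]|x [q _]].
    rewrite /= in_itv/= andbT => rk; have [q rqk] := rat_in_itvoo rk.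
    move: rqk; rewrite in_itv/= => /andP[rq qk].
    exists q => //; rewrite rq; split => //; split; first by rewrite /= in_itv/= qk.
    by move=> Zx; apply: nNx; exists q.
  case: ifP => // rq [[/= + _] nNx]; rewrite !in_itv/= !andbT => qk.
  split; [exact: nNx|by rewrite (lt_trans rq)].
apply: bigcupT_measurable_rat => q; case: ifP => // _.
by apply: measurableD => //; case: (HZ q).
Qed.

(** The identity, from the Lebesgue to the Borel structure, pushes the completed measure forward to
    [mu]; the claim is the change of variables formula for it. *)
Lemma completed_integral_borel (D : set R) (k : R -> \bar R) : measurable D ->
  measurable_fun D k -> (forall x, D x -> 0 <= k x)%E ->
  (\int[cmu]_(x in (D : set (lebesgueType R))) k x = \int[mu]_(x in D) k x)%E.
Proof.
move=> mD mk k0.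
have mid : measurable_fun (setT : set (lebesgueType R)) (idfun : lebesgueType R -> measurableTypeR R).
  by move=> _ B mB; rewrite setTI; exact: borel_lebesgue_measurable.
rewrite -(ge0_integral_pushforward mid _ mD mk); last by move=> x; rewrite inE; exact: k0.
exact: eq_measure_integral.
Qed.

(** The representative is [k] set to 0 outside [D] and on the null set off which it is Borel. It
    lets results on Borel functions be applied to the equation, whose data are only Lebesgue
    measurable. *)
Lemma lebesgue_borel_repr (D : set R) (k : R -> R) : measurable D ->
  measurable_fun (D : set (lebesgueType R)) (k : lebesgueType R -> R) ->
  (forall x, D x -> 0 <= k x) ->
  exists k' : R -> R, [/\ measurable_fun setT k', forall x, 0 <= k' x,
    {ae mu, forall x, D x -> k' x = k x} &
    forall E : set R, measurable E -> E `<=` D ->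
    (\int[cmu]_(x in (E : set (lebesgueType R))) (k x)%:E = \int[mu]_(x in E) (k' x)%:E)%E].
Proof.
move=> mD mk k0; pose kD := k \_ D.
have mkD : measurable_fun (setT : set (lebesgueType R)) (kD : lebesgueType R -> R).
  by apply/(measurable_restrictT _ _).1 => //; exact: borel_lebesgue_measurable.
have [N [mN N0 mkN]] := lebesgue_measurable_fun_borel mkD.
pose k' := kD \_ (~` N).
have mk' : measurable_fun setT k'.
  by apply/(measurable_restrictT _ _).1 => //; exact: measurableC.
have k'0 x : 0 <= k' x.
  by rewrite /k' /kD /patch; case: ifP => // _; case: ifP => // /set_mem; exact: k0.
have kk' x : ~ N x -> D x -> k' x = k x.
  by move=> nNx Dx; rewrite /k' /kD /patch !mem_set.
exists k'; split => //.
  exists N; split => // x /= H; apply: contrapT => nNx; apply: H => Dx; exact: kk'.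
move=> E mE ED; rewrite -completed_integral_borel//; last first.
- by move=> x _; rewrite lee_fin.
- by apply/measurable_EFinP; exact: measurable_funTS.
apply: ge0_ae_eq_integral => //.
- exact: borel_lebesgue_measurable.
- apply/measurable_EFinP; apply: measurable_funS mk => //; exact: borel_lebesgue_measurable.
- apply/measurable_EFinP => _ B mB; apply: borel_lebesgue_measurable.
  by apply: measurable_funTS.
- by move=> x /ED Dx; rewrite lee_fin k0.
- by move=> x _; rewrite lee_fin.
- exists N; split => //; first exact: borel_lebesgue_measurable.
  by move=> x /= H; apply: contrapT => nNx; apply: H => /ED Dx; rewrite kk'.
Qed.

End Completion.

(** * Comparing increments of absolutely continuous functions with integrals *)

Section FTC.
Context {R : realType}.
Local Notation mu := (@lebesgue_measure R).
Local Notation cmu := (@completed_lebesgue_measure R).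
Local Notation I := (`[0, 1]%classic : set R).

Lemma ac_indefinite_integral (k : R -> R) : mu.-integrable setT (EFin \o k) ->
  exists K : R -> R, [/\ abs_continuous K,
    {ae mu, forall x, derivable K x 1 /\ derive1 K x = k x} &
    forall a b, a <= b -> (\int[mu]_(t in `[a, b]) (k t)%:E = (K b - K a)%:E)%E].
Proof.
move=> ik; exists (fun x => (\int[mu]_(t in `]-oo, x]) k t)%R).
have ikD (D : set R) : measurable D -> mu.-integrable D (EFin \o k).
  by move=> mD; apply: integrableS ik.
split; first exact: ac_integral.
  apply: FTC1Ny; first by move=> y; exact: ikD.
  by rewrite -(patch_setT (fun=> 0) k); exact: integrable_locally_restrict.
move=> a b ab; rewrite Rintegral_itvB ?bnd_simp//; last exact: ikD.
rewrite Rintegral_itv_obnd_cbnd; last exact: ikD.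
by rewrite fineK//; apply: integrable_fin_num => //; exact: ikD.
Qed.

Lemma derivableB1 (F G : R -> R) t : derivable F t 1 -> derivable G t 1 ->
  derivable (fun x => F x - G x) t 1 /\
  derive1 (fun x => F x - G x) t = derive1 F t - derive1 G t.
Proof.
move=> dF dG; split; first exact: derivableB.
by rewrite !derive1E; exact: deriveB.
Qed.

(** Integrability of [k] is part of the conclusion, so [k] is first truncated at height [n]: with
    [K] an indefinite integral of the truncation, [F - K] is nondecreasing. Monotone convergence
    then removes the truncation. *)
Lemma ac_integral_le (F k : R -> R) a b : abs_continuous F ->
  0 <= a -> a <= b -> b <= 1 ->
  measurable_fun (I : set (lebesgueType R)) (k : lebesgueType R -> R) ->
  (forall t, I t -> 0 <= k t) ->
  {ae mu, forall t, a <= t <= b -> derivable F t 1 /\ k t <= derive1 F t} ->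
  (\int[cmu]_(t in (`[a, b]%classic : set (lebesgueType R))) (k t)%:E <= (F b - F a)%:E)%E.
Proof.
move=> acF a0 ab b1 mk k0 aeF.
have [k' [mk' k'0 k'k ->]] := lebesgue_borel_repr (measurable_itv `[0, 1]) mk k0; last 2 first.
- exact: measurable_itv.
- by move=> x /=; rewrite !in_itv/=; lra.
pose g n : R -> \bar R := EFin \o (fun x => Num.min (k' x) n%:R).
have mg n : measurable_fun setT (fun x => Num.min (k' x) n%:R).
  by apply: measurable_minr => //; exact: measurable_cst.
have g0 n x : 0 <= Num.min (k' x) n%:R by rewrite le_min k'0 /=.
have limg x : (g n x @[n --> \oo] --> (k' x)%:E)%E.
  apply: cvg_near_cst.
  have [m km] : exists m : nat, k' x <= m%:R.
    by exists (Num.truncn (k' x)).+1; apply/ltW/truncnS_gt.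
  near=> n; congr (_%:E); apply/min_idPl; apply: (le_trans km); rewrite ler_nat.
  by near: n; exists m.
have -> : (\int[mu]_(x in `[a, b]) (k' x)%:E =
   lim (\int[mu]_(x in `[a, b]) (g n x) @[n --> \oo]))%E.
  rewrite -monotone_convergence//.
  - by apply: eq_integral => x _; apply/esym/cvg_lim => //.
  - by move=> n; apply/measurable_EFinP; exact: measurable_funTS (mg n).
  - by move=> n x _; rewrite lee_fin.
  - move=> x _ m n mn; rewrite lee_fin le_min ge_min lexx /= ge_min ler_nat mn orbT//.
apply: lime_le.
  apply: ereal_nondecreasing_is_cvgn => m n mn; apply: ge0_le_integral => //.
  - by move=> x _; rewrite lee_fin.
  - by apply/measurable_EFinP; exact: measurable_funTS (mg m).
  - by apply/measurable_EFinP; exact: measurable_funTS (mg n).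
  - move=> x _; rewrite lee_fin le_min ge_min lexx /= ge_min ler_nat mn orbT//.
apply: nearW => n.
pose gn := (fun x => Num.min (k' x) n%:R) \_ `[a, b].
have ign : mu.-integrable setT (EFin \o gn).
  rewrite /gn -restrict_EFin -integrable_mkcond//.
  apply: measurable_bounded_integrable => //.
  - by rewrite /= lebesgue_measure_itv/=; case: ifP => _; rewrite ?ltry// -EFinB ltry.
  - exact: measurable_funTS (mg n).
  exists n%:R; split; first exact: num_real.
  move=> M nM x _ /=; rewrite ger0_norm// (le_trans _ (ltW nM))// ge_min lexx orbT//.
have [K [acK dK Kint]] := ac_indefinite_integral ign.
have -> : (\int[mu]_(x in `[a, b]) g n x = \int[mu]_(x in `[a, b]) (gn x)%:E)%E.
  by apply: eq_integral => x xab; rewrite /gn patchE xab.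
rewrite Kint// lee_fin.
suff : F a - K a <= F b - K b by lra.
apply: (ac_ae_derive_ge0_le (ac_sub acF acK)) => //.
move: aeF k'k dK; apply: (@filterS3 _ _ (ae_filter_ringOfSetsType mu)) => t aeF k'k [dK K'] tab.
have [dF kF] := aeF tab; have [dFK ->] := derivableB1 dF dK.
split => //; rewrite K' subr_ge0 (le_trans _ kF)// /gn patchE mem_set//= ge_min k'k ?lexx//.
by rewrite /= in_itv/=; lra.
Unshelve. all: by end_near. Qed.

(** In this direction no truncation occurs: an infinite integral makes the bound trivial, and
    otherwise the representative of [k] is integrable. *)
Lemma ac_le_integral (F k : R -> R) a b : abs_continuous F ->
  0 <= a -> a <= b -> b <= 1 ->
  measurable_fun (I : set (lebesgueType R)) (k : lebesgueType R -> R) ->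
  (forall t, I t -> 0 <= k t) ->
  {ae mu, forall t, a <= t <= b -> derivable F t 1 /\ derive1 F t <= k t} ->
  ((F b - F a)%:E <= \int[cmu]_(t in (`[a, b]%classic : set (lebesgueType R))) (k t)%:E)%E.
Proof.
move=> acF a0 ab b1 mk k0 aeF.
have [k' [mk' k'0 k'k ->]] := lebesgue_borel_repr (measurable_itv `[0, 1]) mk k0; last 2 first.
- exact: measurable_itv.
- by move=> x /=; rewrite !in_itv/=; lra.
have [->|kfin] := eqVneq (\int[mu]_(x in `[a, b]) (k' x)%:E)%E +oo%E; first by rewrite leey.
pose gn := k' \_ `[a, b].
have ign : mu.-integrable setT (EFin \o gn).
  rewrite /gn -restrict_EFin -integrable_mkcond//.
  apply/integrableP; split; first by apply/measurable_EFinP; exact: measurable_funTS.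
  under eq_integral do rewrite /= ger0_norm//.
  by rewrite ltey.
have [K [acK dK Kint]] := ac_indefinite_integral ign.
have -> : (\int[mu]_(x in `[a, b]) (k' x)%:E = \int[mu]_(x in `[a, b]) (gn x)%:E)%E.
  by apply: eq_integral => x xab; rewrite /gn patchE xab.
rewrite Kint// lee_fin.
suff : K a - F a <= K b - F b by lra.
apply: (ac_ae_derive_ge0_le (ac_sub acK acF)) => //.
move: aeF k'k dK; apply: (@filterS3 _ _ (ae_filter_ringOfSetsType mu)) => t aeF k'k [dK K'] tab.
have [dF kF] := aeF tab; have [dFK ->] := derivableB1 dK dF.
split => //; rewrite K' subr_ge0 (le_trans kF)// /gn patchE mem_set//= k'k//.
by rewrite /= in_itv/=; lra.
Qed.

End FTC.

(** * Measure-preserving transforms: integrals, inverses and null sets *)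

Section MeasurePreserving.
Context {R : realType}.
Local Notation mu := (@lebesgue_measure R).
Local Notation cmu := (@completed_lebesgue_measure R).
Local Notation I := (`[0, 1]%classic : set R).
Local Notation L := (lebesgueType R).
Implicit Types (sg pi : R -> R) (E : set R).

Lemma mp_in sg t : measure_preserving_transform sg -> I t -> I (sg t).
Proof. by move=> [[h _ _] _]; exact: h. Qed.

Lemma inv01_in pi t : measure_preserving_transform pi -> I t -> I (inv01 pi t).
Proof. by move=> [b _]; have [h _ _] := bijpinv_bij (fun=> point) b; exact: h. Qed.

Lemma inv01K pi t : measure_preserving_transform pi -> I t -> pi (inv01 pi t) = t.
Proof. by move=> [[_ _ h] _] It; apply: (surjpK (fun=> point) h); rewrite inE. Qed.

Lemma inv01KV pi t : measure_preserving_transform pi -> I t -> inv01 pi (pi t) = t.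
Proof. by move=> [[_ h _] _] It; apply: (pinvKV (fun=> point) h); rewrite inE. Qed.

Lemma mp_measurable_fun sg d (T : measurableType d) (k : L -> T) :
  measure_preserving_transform sg ->
  measurable_fun (I : set L) k -> measurable_fun (I : set L) (k \o sg).
Proof.
move=> mp mk mI B mB.
have := (mp.2 (I `&` k @^-1` B) _ (mk mI B mB)).1.
rewrite (_ : I `&` (k \o sg) @^-1` B = I `&` sg @^-1` (I `&` k @^-1` B)).
  by apply => x [].
apply/seteqP; split => [x [Ix kx]|x [Ix [_ kx]]] //; split => //; split => //.
exact: mp_in.
Qed.

Lemma mp_integral sg (k : R -> R) : measure_preserving_transform sg ->
  measurable_fun (I : set L) (k : L -> R) -> (forall t, I t -> 0 <= k t) ->
  (\int[cmu]_(t in (I : set L)) (k (sg t))%:E = \int[cmu]_(t in (I : set L)) (k t)%:E)%E.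
Proof.
move=> mp mk k0.
(* Extended by the identity, [sg] becomes a measurable self-map of the whole line under which [I] is
   its own preimage, so the pushforward formula applies. *)
pose s (x : L) : L := if x \in I then sg x else x.
have mI : measurable (I : set L) by exact: borel_lebesgue_measurable.
have sE (A : set R) : s @^-1` A = (I `&` sg @^-1` (I `&` A)) `|` (A `\` I).
  apply/seteqP; split => x; rewrite /= /s.
    case: ifPn => [/set_mem Ix Ax|/negP nIx Ax]; [left|right].
      by split => //; split => //; exact: mp_in.
    by split => // Ix; apply: nIx; rewrite inE.
  by case=> [[Ix [_ Ax]]|[Ax nIx]]; [rewrite mem_set|rewrite memNset].
have ms : measurable_fun (setT : set L) s.
  move=> _ A mA; rewrite setTI sE; apply: measurableU; last exact: measurableD.
  exact: (mp.2 _ (@subIsetl _ I A) (measurableI _ _ mI mA)).1.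
have mkE : measurable_fun (I : set L) (EFin \o (k : L -> R)) by apply/measurable_EFinP.
have := ge0_integral_pushforward ms cmu mI mkE.
have -> : s @^-1` I = I.
  rewrite sE setDv setU0 setIid; apply/seteqP; split => [x []//|x Ix]; split => //.
  exact: mp_in.
move=> H; transitivity (\int[cmu]_(x in (I : set L)) ((EFin \o k) \o s) x)%E.
  by apply: eq_integral => x xI; rewrite /= /s xI.
rewrite -H; last by move=> x; rewrite inE => Ix; rewrite lee_fin k0.
apply: eq_measure_integral => A mA AI.
transitivity (cmu (s @^-1` A)) => //; rewrite sE (_ : A `\` I = set0) ?setU0; last first.
  by apply/seteqP; split => // x [/AI].
by rewrite (setIidr AI); case: (mp.2 _ AI mA).
Qed.

(* E is exhausted up to a null set by compact sets on which pi is continuous. *)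
Lemma mp_image_inner pi E : measure_preserving_transform pi -> E `<=` I ->
  lebesgue_measurable E -> exists B : set R,
  [/\ measurable B, B `<=` pi @` E & mu B = cmu E].
Proof.
move=> mp EI mE.
have mI : measurable (I : set L) by exact: borel_lebesgue_measurable.
have mpi : measurable_fun (setT : set L) ((pi \_ I) : L -> R).
  apply/(measurable_restrictT _ _).1 => // _ B mB.
  have := (mp.2 (I `&` B) _ _).1; rewrite (_ : I `&` pi @^-1` (I `&` B) = I `&` pi @^-1` B).
    by apply => [x []//|]; apply: borel_lebesgue_measurable; exact: measurableI.
  apply/seteqP; split => [x [Ix [_ kx]]|x [Ix kx]] //; split => //; split => //.
  exact: mp_in.
have [N [mN N0 mNpi]] := lebesgue_measurable_fun_borel mpi.
have [M [mM M0 mEM]] := lebesgue_measurable_borel mE.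
pose A := E `\` M `\` N.
have mA : measurable A by exact: measurableD.
have AE : A `<=` E by move=> x [[]].
have AI : A `<=` I by exact: subset_trans EI.
have cA : cmu E = mu A.
  rewrite -completed_lebesgue_measureE.
  have E' : E = A `|` (E `&` (M `|` N)).
    apply/seteqP; split => [x Ex|x [/AE//|[]//]].
    have [?|nM] := pselect (M x); first by right; split => //; left.
    have [?|nN] := pselect (N x); first by right; split => //; right.
    by left.
  rewrite [in LHS]E'; apply: measureU0.
  - exact: borel_lebesgue_measurable.
  - by apply: measurableI => //; apply: borel_lebesgue_measurable; exact: measurableU.
  - apply: (@subset_measure0 _ _ _ cmu _ (M `|` N)) => //.
    + by apply: measurableI => //; apply: borel_lebesgue_measurable; exact: measurableU.
    + by apply: borel_lebesgue_measurable; exact: measurableU.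
    + by transitivity (mu (M `|` N)) => //; rewrite measureU0.
have finA : (mu A < +oo)%E.
  apply: (@le_lt_trans _ _ (mu I)); first by rewrite le_measure// inE.
  by rewrite /= lebesgue_measure_itv/=; case: ifP => _; rewrite ?ltry// -EFinB ltry.
have mfA : measurable_fun A (pi \_ I).
  by apply: measurable_funS mNpi; [exact: measurableC|move=> x []].
have K_ n : exists K, [/\ compact K, K `<=` A, (mu (A `\` K) < (n.+1%:R^-1)%:E)%E &
    {within K, continuous (pi \_ I)}].
  by apply: measurable_almost_continuous.
pose K n := sval (cid (K_ n)).
have KP n : [/\ compact (K n), K n `<=` A, (mu (A `\` K n) < (n.+1%:R^-1)%:E)%E &
    {within K n, continuous (pi \_ I)}] := svalP (cid (K_ n)).
have mK n : measurable (K n) by case: (KP n) => /compact_measurable.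
pose S := \bigcup_n K n.
have mS : measurable S by exact: bigcupT_measurable.
have SA : S `<=` A by move=> x [n _ Kx]; case: (KP n) => _ /(_ x Kx).
have ADS : mu (A `\` S) = 0%E.
  apply/eqP; rewrite eq_le measure_ge0 andbT; apply/lee_addgt0Pr => e e0; rewrite add0e.
  have [n ne] : exists n : nat, n.+1%:R^-1 < e.
    exists (Num.truncn e^-1); rewrite invf_plt ?posrE ?ltr0Sn//.
    exact: truncnS_gt.
  case: (KP n) => _ KA AK _.
  apply: (@le_trans _ _ (mu (A `\` K n))); last by rewrite (le_trans (ltW AK))// lee_fin ltW.
  rewrite le_measure ?inE//; [exact: measurableD|apply: measurableD => //; exact: mK|].
  by move=> x [Ax nS]; split => // Kx; apply: nS; exists n.
(* Each [K n] is compact and [pi] is continuous on it, so its image is compact; the image of [S] is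
   a countable union of compact sets. *)
have mpiS : measurable (pi @` S).
  rewrite image_bigcup; apply: bigcupT_measurable => n; apply: compact_measurable.
  have -> : pi @` K n = (pi \_ I) @` K n.
    apply: eq_imagel => x Kx; rewrite patchE mem_set//.
    by case: (KP n) => _ KA _ _; apply/AI/KA.
  by apply: continuous_compact; case: (KP n).
exists (pi @` S); split => //.
- by apply: image_subset => x /SA/AE.
- have SI : S `<=` I by move=> x /SA/AI.
  have piSI : pi @` S `<=` I by move=> _ [x /SI Ix <-]; exact: mp_in.
  rewrite cA -completed_lebesgue_measureE.
  rewrite -(mp.2 _ piSI (borel_lebesgue_measurable mpiS)).2.
  (* Measure preservation speaks of preimages; by injectivity the preimage of the image of [S] is
     [S] itself. *)
  have -> : I `&` pi @^-1` (pi @` S) = S.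
    apply/seteqP; split => [x [Ix [y Sy pixy]]|x Sx]; last by split; [exact: SI|exists x].
    suff <- : y = x by [].
    by rewrite -(inv01KV mp Ix) -pixy inv01KV//; exact: SI.
  rewrite completed_lebesgue_measureE.
  transitivity (mu (A `\` S) + mu (A `&` S))%E; last exact/esym/measureDI.
  by rewrite ADS add0e; congr (mu _); apply/esym/setIidr.
Qed.

(* The inner approximations of the images of E and of its complement are disjoint
   and have total measure 1, so they miss only a null set. *)
Lemma mp_image pi E : measure_preserving_transform pi -> E `<=` I ->
  lebesgue_measurable E ->
  lebesgue_measurable (pi @` E) /\ cmu (pi @` E) = cmu E.
Proof.
move=> mp EI mE.
have piEI : pi @` E `<=` I by move=> _ [x /EI Ix <-]; exact: mp_in.
suff mpiE : lebesgue_measurable (pi @` E).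
  split => //; rewrite -(mp.2 _ piEI mpiE).2; congr (cmu _).
  apply/seteqP; split => [x [Ix [y Ey pixy]]|x Ex]; last by split; [exact: EI|exists x].
  suff <- : y = x by [].
  by rewrite -(inv01KV mp Ix) -pixy inv01KV//; exact: EI.
have mI : lebesgue_measurable I by exact: borel_lebesgue_measurable.
have mE' : lebesgue_measurable (I `\` E) by exact: measurableD.
have [B [mB BE Bmu]] := mp_image_inner mp EI mE.
have [C [mC CE Cmu]] := mp_image_inner mp (@subDsetl _ I E) mE'.
have BI : B `<=` I by exact: subset_trans piEI.
have CI : C `<=` I by move=> x /CE [y [Iy _] <-]; exact: mp_in.
have disj x y : E x -> I y -> ~ E y -> pi x <> pi y.
  move=> Ex Iy nEy xy; apply: nEy; rewrite -(inv01KV mp Iy) -xy inv01KV//; exact: EI.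
have D0 : mu (I `\` (B `|` C)) = 0%E.
  have muI : mu I = 1%E.
    by rewrite /= lebesgue_measure_itv/= lte_fin ltr01 -EFinB subr0.
  have muBC : mu (B `|` C) = 1%E.
    transitivity (mu B + mu C)%E.
      apply: measureU => //; apply/seteqP; split => // x [/BE[y Ey <-] /CE[z [Iz nEz]]] zy.
      by case: (disj _ _ Ey Iz nEz).
    rewrite Bmu Cmu -muI; transitivity (cmu (E `|` (I `\` E))); last by rewrite setDUK.
    by apply/esym; apply: measureU => //; rewrite setDIK.
  transitivity (mu I - mu (I `&` (B `|` C)))%E.
    apply: measureD => //; first exact: measurableU.
    by apply: (@le_lt_trans _ _ 1%E); rewrite ?ltry// -muI.
  have -> : I `&` (B `|` C) = B `|` C by apply/setIidr; rewrite subUset.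
  by rewrite muI muBC subee.
have -> : pi @` E = B `|` (pi @` E `\` B).
  by rewrite setDUK.
apply: measurableU; first exact: borel_lebesgue_measurable.
apply: (null_lebesgue_measurable _ D0).
  by apply: measurableD => //; exact: measurableU.
move=> x [[y Ey <-] nB]; split; first exact: mp_in mp (EI _ Ey).
case=> // /CE [z [Iz nEz]] zy; exact: (disj _ _ Ey Iz nEz).
Qed.

(** Preimages under the inverse are images under [pi], so [mp_image] is the whole content. *)
Lemma mp_inv01 pi : measure_preserving_transform pi ->
  measure_preserving_transform (inv01 pi).
Proof.
move=> mp; split; first by apply: (bijpinv_bij (fun=> point)); case: mp.
move=> E EI mE.
have -> : I `&` inv01 pi @^-1` E = pi @` E.
  apply/seteqP; split => [x [Ix Ex]|_ [y Ey <-]].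
    by exists (inv01 pi x) => //; exact: inv01K.
  split; first exact: mp_in mp (EI _ Ey).
  by rewrite /= inv01KV//; exact: EI.
exact: mp_image.
Qed.

(** The exceptional set pulls back to a Lebesgue null set, which is then enlarged by a Borel null
    set [M] to become a Borel null set, as the quantifier over [mu] asks. *)
Lemma mp_ae sg (P : R -> Prop) : measure_preserving_transform sg ->
  {ae mu, forall t, I t -> P t} -> {ae mu, forall t, I t -> P (sg t)}.
Proof.
move=> mp [N [mN N0 NP]].
have mIN : lebesgue_measurable (I `&` N).
  by apply: borel_lebesgue_measurable; exact: measurableI.
have [m1 m2] := mp.2 _ (@subIsetl _ I N) mIN.
have z : cmu (I `&` sg @^-1` (I `&` N)) = 0%E.
  rewrite m2; apply: (@subset_measure0 _ _ _ cmu _ N) => //.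
  exact: borel_lebesgue_measurable.
have [M [mM M0 mD]] := lebesgue_measurable_borel m1.
exists (((I `&` sg @^-1` (I `&` N)) `\` M) `|` M); split; first exact: measurableU.
  transitivity (mu ((I `&` sg @^-1` (I `&` N)) `\` M)); first exact: measureU0.
  apply: (@subset_measure0 _ _ _ cmu _ (I `&` sg @^-1` (I `&` N))) => //.
  exact: borel_lebesgue_measurable.
move=> x /= /not_implyP[Ix nP].
have [Mx|nMx] := pselect (M x); [by right|left; split => //].
split => //; split; first exact: mp_in.
by apply: NP => /= H; apply: nP; apply: H; exact: mp_in.
Qed.

End MeasurePreserving.

(** * Lipschitz bounds, chain rule and measurability of powers *)

Section Calculus.
Context {R : realType}.
Implicit Types (F G g : R -> R).

Lemma derive1_bounded_lipschitz G g (x0 x1 C : R) :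
  (forall u, x0 <= u <= x1 -> derivable G u 1 /\ derive1 G u = g u) ->
  (forall u, x0 <= u <= x1 -> `|g u| <= C) ->
  forall u v, x0 <= u <= x1 -> x0 <= v <= x1 -> `|G u - G v| <= C * `|u - v|.
Proof.
move=> dG gC.
suff H u v : x0 <= u -> u <= v -> v <= x1 -> `|G u - G v| <= C * `|u - v|.
  move=> u v ux vx; case: (leP u v) => uv; first by apply: H; lra.
  by rewrite distrC (distrC u); apply: H; lra.
move=> xu uv vx.
have [|c|c] := @MVT_segment R G g u v uv.
- move=> z; rewrite in_itv/= => uzv.
  have [dz <-] : derivable G z 1 /\ derive1 G z = g z by apply: dG; lra.
  by rewrite derive1E; exact: derivableP.
- apply: derivable_within_continuous => z; rewrite in_itv/= => uzv.
  by apply: (dG _ _).1; lra.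
rewrite in_itv/= distrC (distrC u) => ucv ->.
by rewrite normrM ler_wpM2r// gC//; lra.
Qed.

Lemma derivable_comp1 F G t : derivable F t 1 -> derivable G (F t) 1 ->
  derivable (G \o F) t 1.
Proof.
by move=> /derivable1_diffP dF /derivable1_diffP dG; apply/derivable1_diffP; exact: differentiable_comp.
Qed.

Lemma measurable_fun_powR2 d (T : measurableType d) (D : set T) (F G : T -> R) :
  measurable D -> measurable_fun D F -> measurable_fun D G ->
  measurable_fun D (fun t => F t `^ G t).
Proof.
move=> mD mF mG; rewrite /powR.
apply: measurable_fun_if => //.
- by apply: measurable_fun_eqr => //; exact: measurable_cst.
- apply: (@measurableT_comp _ _ _ _ _ _ (fun b : bool => b%:R : R)) => //.
  apply: (measurable_funS mD) => //; apply: measurable_fun_eqr => //; exact: measurable_cst.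
- apply: (measurable_funS mD) => //; apply: measurableT_comp => //.
  by apply: measurable_funM => //; apply: measurableT_comp => //; exact: measurable_ln.
Qed.

End Calculus.

(** * Consequences of the differential equation for positive initial value *)

Section Ode.
Context {R : realType}.
Local Notation mu := (@lebesgue_measure R).
Local Notation cmu := (@completed_lebesgue_measure R).
Local Notation I := (`[0, 1]%classic : set R).
Local Notation L := (lebesgueType R).
Implicit Types (p f phi G g k w : R -> R).

Lemma unit_itvE t : I t = (0 <= t <= 1) :> Prop.
Proof. by rewrite /= in_itv. Qed.

Lemma mem_unit_itv t : 0 <= t -> t <= 1 -> t \in I.
Proof. by move=> t0 t1; rewrite inE unit_itvE t0. Qed.

Definition ode_coef p f t := `|f t| `^ p t / p t.

Lemma ode_coef_ge0 p f t : 1 <= p t -> 0 <= ode_coef p f t.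
Proof. by move=> p1; rewrite divr_ge0// ?powR_ge0//; lra. Qed.

Lemma ode_coef_measurable p f : (forall t, I t -> 1 <= p t) ->
  lebesgue_measurable_fun p -> lebesgue_measurable_fun f ->
  lebesgue_measurable_fun (ode_coef p f).
Proof.
move=> p1 mp mf.
have mI : measurable (I : set L) by exact: borel_lebesgue_measurable.
apply: measurable_funM.
  apply: (measurable_fun_powR2 mI _ mp).
  exact: (measurableT_comp (@normr_measurable R setT) mf).
(* The reciprocal is treated as a power, which agrees with it since [p t >= 1]. *)
apply: (@eq_measurable_fun _ _ _ _ _ (fun t : L => p t `^ (- 1))).
  by move=> t; rewrite inE => It; rewrite powR_inv1//; have := p1 t It; lra.
apply: (measurable_fun_powR2 mI mp); exact: measurable_cst.
Qed.

Section Solution.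
Variables (p f phi : R -> R) (x0 : R).
Hypotheses (p1 : forall t, I t -> 1 <= p t) (x00 : 0 < x0)
  (sol : ode_solution p f x0 phi).

Lemma ode_ge t : I t -> x0 <= phi t.
Proof.
move=> It; have /andP[t0 t1] : 0 <= t <= 1 by rewrite -unit_itvE.
by case: sol => _ mon <- _; apply: mon => //; apply: mem_unit_itv.
Qed.

Lemma ode_le1 t : I t -> phi t <= phi 1.
Proof.
move=> It; have /andP[t0 t1] : 0 <= t <= 1 by rewrite -unit_itvE.
by case: sol => _ mon _ _; apply: mon => //; apply: mem_unit_itv.
Qed.

(** Since [phi >= x0 > 0], the infinite branch of [ode_rhs] never occurs, and the branch [f t = 0]
    agrees with the formula because 0 to the power [p t] is 0. *)
Lemma ode_ae : {ae mu, forall t, I t -> derivable phi t 1 /\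
  derive1 phi t = ode_coef p f t * phi t `^ (1 - p t)}.
Proof.
case: (sol) => _ _ _; apply: (@filterS _ _ (ae_filter_ringOfSetsType mu)) => t H It.
have [dphi] := H It; split => //.
have ph0 : phi t != 0 by apply: lt0r_neq0; exact: lt_le_trans x00 (ode_ge It).
move: b; rewrite /ode_rhs (negbTE ph0) /=.
case: eqP => [f0 [->]|_ [->]//].
by rewrite /ode_coef f0 normr0 powR0 ?mul0r//; have := p1 It; lra.
Qed.

Section Comp.
Variables (G g : R -> R) (C : R).
Hypotheses (dG : forall u, x0 <= u -> derivable G u 1 /\ derive1 G u = g u)
  (gC : forall u, x0 <= u <= phi 1 -> `|g u| <= C).

(** [phi] stays in [[x0, phi 1]], where the bound on [g] makes [G] Lipschitz. *)
Lemma ode_comp_ac : abs_continuous (G \o phi).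
Proof.
have [ac _ _ _] := sol.
apply: (@ac_lipschitz_comp _ phi G C) => // s t s01 t01.
apply: (@derive1_bounded_lipschitz _ G g x0 (phi 1)).
- by move=> u /andP[ux _]; exact: dG.
- exact: gC.
- by rewrite ode_ge ?ode_le1 ?unit_itvE.
- by rewrite ode_ge ?ode_le1 ?unit_itvE.
Qed.

Lemma ode_comp_ae : {ae mu, forall t, I t -> derivable (G \o phi) t 1 /\
  derive1 (G \o phi) t = ode_coef p f t * phi t `^ (1 - p t) * g (phi t)}.
Proof.
have := ode_ae; apply: (@filterS _ _ (ae_filter_ringOfSetsType mu)) => t H It.
have [dphi <-] := H It; have [dGt <-] := dG (ode_ge It).
split; first exact: (derivable_comp1 dphi dGt).
by rewrite (derive1_comp dphi dGt) mulrC.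
Qed.

(** This lemma and the next carry every later comparison: a pointwise inequality between [k] and the
    a.e. derivative of [G \o phi] is integrated. *)
Lemma ode_comp_le_integral k a b : 0 <= a -> a <= b -> b <= 1 ->
  lebesgue_measurable_fun k -> (forall t, I t -> 0 <= k t) ->
  {ae mu, forall t, I t -> a <= t <= b ->
     ode_coef p f t * phi t `^ (1 - p t) * g (phi t) <= k t} ->
  ((G (phi b) - G (phi a))%:E <=
   \int[cmu]_(t in (`[a, b]%classic : set L)) (k t)%:E)%E.
Proof.
move=> a0 ab b1 mk k0 H; apply: (@ac_le_integral _ (G \o phi)) => //.
  exact: ode_comp_ac.
have := ode_comp_ae; move: H; apply: (@filterS2 _ _ (ae_filter_ringOfSetsType mu)) => t kt Gt tab.
have It : I t by rewrite unit_itvE; lra.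
by have [d ->] := Gt It; split => //; exact: kt.
Qed.

Lemma ode_comp_integral_le k a b : 0 <= a -> a <= b -> b <= 1 ->
  lebesgue_measurable_fun k -> (forall t, I t -> 0 <= k t) ->
  {ae mu, forall t, I t -> a <= t <= b ->
     k t <= ode_coef p f t * phi t `^ (1 - p t) * g (phi t)} ->
  (\int[cmu]_(t in (`[a, b]%classic : set L)) (k t)%:E <= 
   (G (phi b) - G (phi a))%:E)%E.
Proof.
move=> a0 ab b1 mk k0 H; apply: (@ac_integral_le _ (G \o phi)) => //.
  exact: ode_comp_ac.
have := ode_comp_ae; move: H; apply: (@filterS2 _ _ (ae_filter_ringOfSetsType mu)) => t kt Gt tab.
have It : I t by rewrite unit_itvE; lra.
by have [d ->] := Gt It; split => //; exact: kt.
Qed.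

End Comp.
End Solution.

Lemma integral01_split k c : lebesgue_measurable_fun k ->
  (forall t, I t -> 0 <= k t) -> I c ->
  (\int[cmu]_(t in (I : set L)) (k t)%:E =
   \int[cmu]_(t in (`[0%R, c]%classic : set L)) (k t)%:E +
   \int[cmu]_(t in (`[c, 1%R]%classic : set L)) (k t)%:E)%E.
Proof.
move=> mk k0 Ic; rewrite unit_itvE in Ic.
have [k' [mk' k'0 _ kk']] := lebesgue_borel_repr (measurable_itv `[0, 1]) mk k0.
rewrite !kk'//; last 2 first.
- by move=> x /=; rewrite !in_itv/=; lra.
- by move=> x /=; rewrite !in_itv/=; lra.
have -> : I = `[0, c]%classic `|` `]c, 1]%classic.
  by rewrite -itv_bndbnd_setU// bnd_simp; lra.
rewrite ge0_integral_setU//; last 3 first.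
- by apply/measurable_EFinP; exact: measurable_funTS.
- by move=> x _; rewrite lee_fin.
- apply/disj_set2P; apply/seteqP; split => // x /= []; rewrite !in_itv/=; lra.
congr (_ + _)%E; apply: integral_itv_obnd_cbnd.
by apply/measurable_EFinP; exact: measurable_funTS.
Qed.

End Ode.

(** * Upper bounds for an arbitrary rearrangement *)

Section Bound.
Context {R : realType}.
Local Notation mu := (@lebesgue_measure R).
Local Notation cmu := (@completed_lebesgue_measure R).
Local Notation I := (`[0, 1]%classic : set R).
Local Notation L := (lebesgueType R).

Lemma ler_powR_base (r x y : R) : 0 <= r -> 0 <= x -> x <= y -> x `^ r <= y `^ r.
Proof.
move=> r0 x0 xy; apply: (ge0_ler_powR r0 _ _ xy); rewrite nnegrE//.
exact: le_trans xy.
Qed.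

Lemma le0_ger_powR (r x y : R) : r <= 0 -> 0 < x -> x <= y -> y `^ r <= x `^ r.
Proof.
move=> r0 x0 xy; have y0 : 0 < y by lra.
rewrite -(opprK r) 2!(powRN _ (- r)) lef_pV2 ?posrE ?powR_gt0//.
by apply: ler_powR_base; lra.
Qed.

Lemma eq_lebesgue_measurable_fun (k k' : R -> R) : (forall t, I t -> k t = k' t) ->
  lebesgue_measurable_fun k -> lebesgue_measurable_fun k'.
Proof. by move=> H; apply: eq_measurable_fun => t; rewrite inE; exact: H. Qed.

Section Rearrangement.
Variables (p f sg p2 f2 phi phi2 : R -> R) (x0 : R).
Hypotheses (mp : measure_preserving_transform sg)
  (m_p : lebesgue_measurable_fun p) (m_f : lebesgue_measurable_fun f)
  (p1 : forall t, I t -> 1 <= p t)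
  (p2E : forall t, I t -> p2 t = p (sg t)) (f2E : forall t, I t -> f2 t = f (sg t))
  (x00 : 0 < x0) (sol : ode_solution p f x0 phi) (sol2 : ode_solution p2 f2 x0 phi2).

Let p21 t : I t -> 1 <= p2 t.
Proof. by move=> It; rewrite p2E//; apply: p1; exact: mp_in. Qed.

Variable N : R.
Hypothesis NE : N = phi 1.
Let k t := ode_coef p f t * N `^ (1 - p t).
Let k2 t := ode_coef p2 f2 t * N `^ (1 - p2 t).

Let I0 : I 0. Proof. by rewrite unit_itvE; lra. Qed.
Let I1 : I 1. Proof. by rewrite unit_itvE; lra. Qed.

Let xN : x0 <= N. Proof. rewrite NE; exact: (ode_ge sol I1). Qed.

Let k0 t : I t -> 0 <= k t.
Proof. by move=> It; rewrite mulr_ge0 ?powR_ge0 ?ode_coef_ge0 ?p1. Qed.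

Let k20 t : I t -> 0 <= k2 t.
Proof. by move=> It; rewrite mulr_ge0 ?powR_ge0 ?ode_coef_ge0 ?p21. Qed.

Let mI : measurable (I : set L). Proof. exact: borel_lebesgue_measurable. Qed.

Let mk : lebesgue_measurable_fun k.
Proof.
apply: measurable_funM; first exact: ode_coef_measurable.
apply: (measurable_fun_powR2 mI (measurable_cst _)).
exact: (measurable_funB (measurable_cst _) m_p).
Qed.

Let k2E t : I t -> k (sg t) = k2 t.
Proof. by move=> It; rewrite /k /k2 /ode_coef p2E// f2E. Qed.

Let mk2 : lebesgue_measurable_fun k2.
Proof.
apply: (eq_lebesgue_measurable_fun k2E); exact: (mp_measurable_fun mp mk).
Qed.

(** By invariance it suffices to integrate [k], and [k] is at most the derivative of [phi], because
    [phi <= N] and the exponent [1 - p] is nonpositive. *)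
Let int_k2 : (\int[cmu]_(t in (I : set L)) (k2 t)%:E <= (N - x0)%:E)%E.
Proof.
have -> : (\int[cmu]_(t in (I : set L)) (k2 t)%:E = \int[cmu]_(t in (I : set L)) (k t)%:E)%E.
  rewrite -(mp_integral mp mk k0); apply: eq_integral => t; rewrite inE => It.
  by rewrite k2E.
have -> : x0 = phi 0 by case: sol.
rewrite NE.
apply: (@ode_comp_integral_le R p f phi x0 p1 x00 sol id (cst 1) 1) => //.
- by move=> u _; rewrite derive1_id; split => //; exact: derivable_id.
- by move=> u _; rewrite normr1.
apply: aeW => t It _; rewrite mulr1 ler_wpM2l ?ode_coef_ge0 ?p1//.
apply: le0_ger_powR; [have := p1 It; lra|exact: lt_le_trans x00 (ode_ge sol It)|].
rewrite NE; exact: (ode_le1 sol).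
Qed.

(** After [t0] one has [phi2 >= N], so the nonpositive exponent [1 - p2] makes [k2] at least the
    derivative of [phi2]. *)
Let upper_part t0 : I t0 -> phi2 t0 = N ->
  ((phi2 1 - N)%:E <= \int[cmu]_(t in (`[t0, 1%R]%classic : set L)) (k2 t)%:E)%E.
Proof.
move=> It0 t0N; rewrite -t0N; have := It0; rewrite unit_itvE => /andP[t00 t01].
apply: (@ode_comp_le_integral R p2 f2 phi2 x0 p21 x00 sol2 id (cst 1) 1) => //.
- by move=> u _; rewrite derive1_id; split => //; exact: derivable_id.
- by move=> u _; rewrite normr1.
apply: aeW => t It tt; rewrite mulr1 ler_wpM2l ?ode_coef_ge0 ?p21//.
apply: le0_ger_powR; [have := p21 It; lra|exact: lt_le_trans x00 xN|].
by rewrite -t0N; case: sol2 => _ mon _ _; apply: mon; rewrite ?inE//; case/andP: tt.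
Qed.

Let crossing : N <= phi2 1 -> exists2 t0, I t0 & phi2 t0 = N.
Proof.
move=> N2; case: (sol2) => ac _ h0 _.
have [|c c01 <-] := @IVT R phi2 0 1 N ler01 (ac_continuous ac).
  by rewrite h0 ge_min le_max xN N2 orbT.
by exists c.
Qed.

(** The integral of [k2] before the crossing time is simply dropped, which gives
    [phi2 1 - N <= N - x0]. *)
Lemma rearrangement_le2 : phi2 1 <= 2 * phi 1.
Proof.
have N0 : 0 < N := lt_le_trans x00 xN.
have [H|/ltW N2] := leP (phi2 1) N; first by rewrite -NE; lra.
have [t0 It0 t0N] := crossing N2.
have : ((phi2 1 - N)%:E <= (N - x0)%:E)%E.
  apply: le_trans (upper_part It0 t0N) (le_trans _ int_k2).
  rewrite (integral01_split mk2 k20 It0) leeDr//.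
  apply: integral_ge0 => t /=; rewrite in_itv/= => tt; rewrite lee_fin k20// unit_itvE.
  by move: It0; rewrite unit_itvE; lra.
by rewrite lee_fin -NE; have := x00; lra.
Qed.

(** Adding the estimates before and after [t0] gives [N / q - x0 / q + phi2 1 - N <= N - x0]; the
    terms in [x0] have the right sign because [q >= 1]. *)
Lemma rearrangement_le_bounded (q : R) : 1 <= q ->
  {ae mu, forall t, I t -> p t <= q} -> phi2 1 <= (2 - q^-1) * phi 1.
Proof.
move=> q1 pq; have q0 : 0 < q by lra.
have x0' := x00; have qV1 : q^-1 <= 1 by rewrite invf_le1.
have N0 : 0 < N := lt_le_trans x00 xN.
have [H|/ltW N2] := leP (phi2 1) N; first by rewrite -NE; nra.
have [t0 It0 t0N] := crossing N2.
have := It0; rewrite unit_itvE => /andP[t00 t01].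
pose c := N `^ (1 - q).
pose G (u : R) := c / q * u `^ q.
have c0 : 0 < c by exact: powR_gt0.
have lower : ((G N - G x0)%:E <= \int[cmu]_(t in (`[0%R, t0]%classic : set L)) (k2 t)%:E)%E.
  have -> : x0 = phi2 0 by case: sol2.
  rewrite -t0N.
  apply: (@ode_comp_le_integral R p2 f2 phi2 x0 p21 x00 sol2 G
    (fun u => c * u `^ (q - 1)) (c * (phi2 1) `^ (q - 1))) => //.
  - move=> u ux; have u0 : u \in `]0, +oo[%R by rewrite in_itv/= andbT; lra.
    have du : derivable (@powR R ^~ q) u 1 by exact: derivable_powR.
    split; first exact: derivableZ.
    rewrite derive1E deriveZ//= -derive1E powR_derive1// /GRing.scale/=.
    by rewrite mulrA divfK// gt_eqF.
  - move=> u /andP[xu u1]; rewrite ger0_norm; last by rewrite mulr_ge0 ?powR_ge0// ltW.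
    by apply: ler_wpM2l; [exact: ltW|apply: ler_powR_base; lra].
  have := mp_ae mp pq; apply: (@filterS _ _ (ae_filter_ringOfSetsType mu)) => t H It tt.
  rewrite /= -mulrA ler_wpM2l ?ode_coef_ge0 ?p21//.
  have phx : x0 <= phi2 t := ode_ge sol2 It.
  have ph0 : 0 < phi2 t by lra.
  have phN : phi2 t <= N.
    by rewrite -t0N; case: sol2 => _ mon _ _; apply: mon; rewrite ?inE//; case/andP: tt.
  have pqt : p2 t <= q by rewrite p2E//; exact: H.
  (* The remaining exponent [q - p2 t] is nonnegative, so [phi2 t] may be replaced by the larger
     [N], which turns the product into [N ^ (1 - p2 t)]. *)
  have -> : phi2 t `^ (1 - p2 t) * (c * phi2 t `^ (q - 1)) = c * phi2 t `^ (q - p2 t).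
    rewrite mulrCA -powRD; last by rewrite (gt_eqF ph0) implybT.
    by congr (_ * _ `^ _); ring.
  have -> : 1 - p2 t = (1 - q) + (q - p2 t) by ring.
  rewrite (@powRD _ N); last by rewrite (gt_eqF N0) implybT.
  by apply: ler_wpM2l; [exact: ltW|apply: ler_powR_base; lra].
have : ((G N - G x0) + (phi2 1 - N) <= N - x0).
  rewrite -lee_fin EFinD; apply: le_trans int_k2.
  by rewrite (integral01_split mk2 k20 It0) leeD// upper_part.
have -> : G N = N / q.
  rewrite /G /c mulrAC -powRD ?(gt_eqF N0) ?implybT//.
  by rewrite subrK powRr1// ltW.
have : G x0 <= x0 / q.
  rewrite /G mulrAC ler_wpM2r ?invr_ge0 ?(ltW q0)//.
  apply: (@le_trans _ _ (x0 `^ (1 - q) * x0 `^ q)).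
    apply: ler_wpM2r; first exact: powR_ge0.
    by apply: le0_ger_powR => //; lra.
  by rewrite -powRD ?(gt_eqF x00) ?implybT// subrK powRr1// ltW.
have : x0 / q <= x0 by rewrite ler_pdivrMr// ler_peMr// ltW.
by rewrite -NE; lra.
Qed.

End Rearrangement.
End Bound.

(** * Primitives, and a convex function with prescribed subgradients *)

Section Primitives.
Context {R : realType}.
Local Notation mu := (@lebesgue_measure R).
Local Notation I := (`[0, 1]%classic : set R).

Lemma antiderivative (m : R -> R) : continuous m ->
  exists G : R -> R, forall u, 0 < u -> derivable G u 1 /\ derive1 G u = m u.
Proof.
move=> cm; exists (fun x => (\int[mu]_(t in `[0, x]) m t)%R) => u u0.
apply: (@continuous_FTC1_closed R m 0 u (u + 1)) => //; first by lra.
  apply: continuous_compact_integrable; first exact: segment_compact.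
  by apply: continuous_subspaceT.
exact: cm.
Qed.

Lemma bounded_integrable_itv (P : R -> R) (c d a b : R) :
  measurable_fun setT P -> (forall v, c <= P v <= d) ->
  mu.-integrable `[a, b] (EFin \o P).
Proof.
move=> mP cPd; apply: measurable_bounded_integrable => //.
- by rewrite /= lebesgue_measure_itv/=; case: ifP => _; rewrite ?ltry// -EFinB ltry.
- exact: measurable_funTS mP.
exists (`|c| + `|d|); split; first exact: num_real.
move=> M cdM x _ /=; apply: le_trans (ltW cdM); have /andP[h1 h2] := cPd x.
rewrite ler_norml; apply/andP; split.
  by have := ler_norm (- c); rewrite normrN; have := normr_ge0 d; lra.
by have := ler_norm d; have := normr_ge0 c; lra.
Qed.

Lemma integrable_itv_cst (c a b : R) : mu.-integrable `]a, b[ (EFin \o cst c).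
Proof.
have i : mu.-integrable `[a, b] (EFin \o cst c).
  by apply: (@bounded_integrable_itv _ c c) => // v; rewrite lexx.
by apply: integrableS i => //; exact: subset_itv_oo_cc.
Qed.

Lemma Rintegral_itv_ge (P : R -> R) (c a b : R) :
  mu.-integrable `[a, b] (EFin \o P) -> a <= b ->
  (forall r, a < r < b -> c <= P r) ->
  c * (b - a) <= (\int[mu]_(t in `]a, b[) P t)%R.
Proof.
move=> iP ab cP.
have iP' : mu.-integrable `]a, b[ (EFin \o P).
  by apply: integrableS iP => //; exact: subset_itv_oo_cc.
have mab : fine (mu `]a, b[%classic) = b - a.
  rewrite lebesgue_measure_itv/= lte_fin; case: ltP => //= ba.
  by have -> : b = a by [lra]; rewrite subrr.
rewrite -mab -(Rintegral_cst mu)//.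
apply: le_Rintegral => //; exact: integrable_itv_cst.
Qed.

Lemma Rintegral_itv_le (P : R -> R) (c a b : R) :
  mu.-integrable `[a, b] (EFin \o P) -> a <= b ->
  (forall r, a < r < b -> P r <= c) ->
  (\int[mu]_(t in `]a, b[) P t)%R <= c * (b - a).
Proof.
move=> iP ab cP.
have iP' : mu.-integrable `]a, b[ (EFin \o P).
  by apply: integrableS iP => //; exact: subset_itv_oo_cc.
have mab : fine (mu `]a, b[%classic) = b - a.
  rewrite lebesgue_measure_itv/= lte_fin; case: ltP => //= ba.
  by have -> : b = a by [lra]; rewrite subrr.
rewrite -mab -(Rintegral_cst mu)//.
apply: le_Rintegral => //; exact: integrable_itv_cst.
Qed.

(** [M] is the integral of the nondecreasing function [P v], the supremum of [rho t] over
    [psi t <= v]. To the right of [psi y] it is at least [rho y], to the left at most [rho y], even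
    where [psi] is flat and [P] jumps. *)
Lemma convex_primitive (rho psi : R -> R) :
  {in I &, {homo rho : s t / s <= t}} ->
  {in I &, {homo psi : s t / s <= t}} ->
  exists M : R -> R, continuous M /\
    forall y v, I y -> psi 0 <= v -> rho y * (v - psi y) <= M v - M (psi y).
Proof.
move=> rho_mon psi_mon; set a := psi 0.
have I0 : (0 : R) \in I by apply: mem_unit_itv; rewrite ?ler01.
have I1 : (1 : R) \in I by apply: mem_unit_itv; rewrite ?ler01.
(* The point 0 is adjoined so that [S v] is nonempty also for [v < psi 0]. *)
pose S v := [set rho t | t in [set t | t \in I /\ (t = 0 \/ psi t <= v)]].
have S0 v : S v (rho 0) by exists 0 => //; split => //; left.
have S1 v : ubound (S v) (rho 1).
  move=> _ [t [It _] <-]; apply: rho_mon => //.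
  by move: It; rewrite inE unit_itvE => /andP[].
have supS v : has_sup (S v) by split; [exists (rho 0)|exists (rho 1)].
pose P v := sup (S v).
have Pge v t : t \in I -> psi t <= v -> rho t <= P v.
  move=> It tv; apply: ub_le_sup; first by case: (supS v).
  by exists t => //; split => //; right.
have Ple y v : y \in I -> v < psi y -> P v <= rho y.
  move=> Iy vy; apply: ge_sup; first by exists (rho 0).
  move=> _ [t [It tv] <-]; apply: rho_mon => //.
  case: tv => [->|tv]; first by move: Iy; rewrite inE unit_itvE => /andP[].
  rewrite leNgt; apply/negP => /ltW yt.
  by have := psi_mon _ _ Iy It yt; lra.
have Pbd v : rho 0 <= P v <= rho 1.
  apply/andP; split; first by apply: ub_le_sup => //; case: (supS v).
  by apply: ge_sup => //; exists (rho 0).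
have Pmon : {homo P : u v / u <= v}.
  move=> u v uv; apply: ge_sup; first by exists (rho 0).
  move=> _ [t [It tu] <-]; apply: ub_le_sup; first by case: (supS v).
  exists t => //; split => //; case: tu => [|tu]; [by left|right; exact: le_trans uv].
have mP : measurable_fun setT P by apply: nondecreasing_measurable.
have iP b c : mu.-integrable `[b, c] (EFin \o P) := bounded_integrable_itv b c mP Pbd.
(* The maximum freezes [M] below [a], which keeps it continuous on the whole line; the subgradient
   inequality concerns only [v >= a]. *)
pose M v := (\int[mu]_(t in `[a, Num.max a v]) P t)%R.
have MB u v : a <= u -> u <= v -> M v - M u = (\int[mu]_(t in `]u, v[) P t)%R.
  move=> au uv; have av : a <= v by exact: le_trans uv.
  rewrite /M (max_idPr au) (max_idPr av) Rintegral_itvB ?bnd_simp//.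
  rewrite Rintegral_itv_bndo_bndc//; apply: integrableS (iP u v) => //.
  exact: subset_itv_oo_cc.
exists M; split.
  pose C := `|rho 0| + `|rho 1|.
  have lip u v : a <= u -> u <= v -> `|M v - M u| <= C * (v - u).
    move=> au uv; rewrite MB// ler_norml; apply/andP; split.
      apply: (@le_trans _ _ (rho 0 * (v - u))).
        rewrite -mulNr ler_wpM2r ?subr_ge0//.
        by have := ler_norm (- rho 0); rewrite normrN /C; have := normr_ge0 (rho 1); lra.
      by apply: Rintegral_itv_ge => // r _; case/andP: (Pbd r).
    apply: (@le_trans _ _ (rho 1 * (v - u))).
      by apply: Rintegral_itv_le => // r _; case/andP: (Pbd r).
    rewrite ler_wpM2r ?subr_ge0//.
    by have := ler_norm (rho 1); rewrite /C; have := normr_ge0 (rho 0); lra.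
  have C0 : 0 <= C by rewrite addr_ge0.
  have lip' u v : `|M u - M v| <= C * `|u - v|.
    wlog uv : u v / u <= v.
      by move=> H; case: (leP u v) => [/H//|/ltW/H]; rewrite distrC (distrC v).
    rewrite distrC (distrC u).
    have -> : M v = M (Num.max a v) by rewrite /M maxA maxxx.
    have -> : M u = M (Num.max a u) by rewrite /M maxA maxxx.
    apply: (le_trans (lip _ _ _ _)); first by rewrite le_max lexx.
      by rewrite ge_max !le_max lexx uv orbT.
    rewrite ler_wpM2l// ger0_norm ?subr_ge0//.
    by case: (leP a v) => av; case: (leP a u) => au; lra.
  move=> x; apply/cvgrPdist_le => e e0; apply/nbhs_ballP.
  exists (e / (C + 1)); first by rewrite /= divr_gt0//; lra.
  move=> z; rewrite /ball/= ltr_pdivlMr; last by lra.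
  move=> xz; apply: (le_trans (lip' _ _)); apply: le_trans (ltW xz).
  by rewrite mulrC ler_wpM2l//; lra.
move=> y v Iy av; have Iy' : y \in I by rewrite inE.
have ay : a <= psi y.
  by apply: psi_mon => //; move: Iy; rewrite unit_itvE => /andP[].
have [yv|vy] := leP (psi y) v.
  rewrite MB//; apply: Rintegral_itv_ge => // r /andP[yr _].
  by apply: Pge => //; exact: ltW.
rewrite -lerN2 opprB -mulrN opprB MB//; last exact: ltW.
apply: Rintegral_itv_le => //; first exact: ltW.
by move=> r /andP[_ ry]; exact: Ple.
Qed.

End Primitives.

(** * Comparison with monotone arrangements of the exponent *)

Section Monotone.
Context {R : realType}.
Local Notation mu := (@lebesgue_measure R).
Local Notation cmu := (@completed_lebesgue_measure R).
Local Notation I := (`[0, 1]%classic : set R).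
Local Notation L := (lebesgueType R).

Lemma unit_itv1 : I 1. Proof. by rewrite unit_itvE ler01 lexx. Qed.

Lemma antiderivative_lt (G m : R -> R) a b : 0 < a -> a < b ->
  (forall u, 0 < u -> derivable G u 1 /\ derive1 G u = m u) ->
  (forall u, 0 < m u) -> G a < G b.
Proof.
move=> a0 ab dG m0.
have [|c|c _ H] := @MVT_segment R G m a b (ltW ab).
- move=> z; rewrite in_itv/= => /andP[az _].
  have [|dz <-] := dG z; first by lra.
  by rewrite derive1E; exact: derivableP.
- apply: derivable_within_continuous => z; rewrite in_itv/= => /andP[az _].
  by apply: (dG _ _).1; lra.
by rewrite -subr_gt0 H mulr_gt0// subr_gt0.
Qed.

Lemma continuous_bounded_itv (m : R -> R) a b : continuous m -> (forall u, 0 < m u) ->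
  exists C, forall u, a <= u <= b -> `|m u| <= C.
Proof.
move=> cm m0; have [ab|ba] := leP a b; last by exists 0 => u; lra.
have [c _ H] := @EVT_max R m a b ab (continuous_subspaceT cm).
by exists (m c) => u uab; rewrite gtr0_norm//; apply: H; rewrite in_itv.
Qed.

Section Calibration.
Variables (p f sg p1 f1 phi phi1 m : R -> R) (x0 : R).
Hypotheses (mp : measure_preserving_transform sg)
  (m_p1 : lebesgue_measurable_fun p1) (m_f1 : lebesgue_measurable_fun f1)
  (p11 : forall t, I t -> 1 <= p1 t)
  (pE : forall t, I t -> p t = p1 (sg t)) (fE : forall t, I t -> f t = f1 (sg t))
  (x00 : 0 < x0) (sol : ode_solution p f x0 phi) (sol1 : ode_solution p1 f1 x0 phi1)
  (cm : continuous m) (m0 : forall u, 0 < m u).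

Let p_ge1 t : I t -> 1 <= p t.
Proof. by move=> It; rewrite pE//; apply: p11; exact: mp_in. Qed.

(** Almost everywhere this is the derivative of [G \o phi1] for a primitive [G] of [m]. *)
Let k1 t := ode_coef p1 f1 t * phi1 t `^ (1 - p1 t) * m (phi1 t).

Let mI : measurable (I : set L). Proof. exact: borel_lebesgue_measurable. Qed.

Let k10 t : I t -> 0 <= k1 t.
Proof.
by move=> It; rewrite mulr_ge0 ?(ltW (m0 _))// mulr_ge0 ?powR_ge0 ?ode_coef_ge0 ?p11.
Qed.

Let mphi1 : measurable_fun (I : set L) (phi1 : L -> R).
Proof.
case: sol1 => /ac_continuous cphi _ _ _ _ B mB; apply: borel_lebesgue_measurable.
by apply: (@subspace_continuous_measurable_fun R I phi1).
Qed.

Let mk1 : lebesgue_measurable_fun k1.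
Proof.
apply: measurable_funM.
  apply: measurable_funM; first exact: ode_coef_measurable.
  by apply: (measurable_fun_powR2 mI mphi1); exact: (measurable_funB (measurable_cst _) m_p1).
by have := measurableT_comp (continuous_measurable_fun cm) mphi1.
Qed.

Let k t := k1 (sg t).

Let mk : lebesgue_measurable_fun k.
Proof. exact: (mp_measurable_fun mp mk1). Qed.

Let k0 t : I t -> 0 <= k t. Proof. by move=> It; apply: k10; exact: mp_in. Qed.

Let kE t : I t -> k t = ode_coef p f t * (phi1 (sg t) `^ (1 - p1 (sg t)) * m (phi1 (sg t))).
Proof. by move=> It; rewrite /k /k1 -mulrA /ode_coef pE// fE. Qed.

Let int_k : (\int[cmu]_(t in (I : set L)) (k t)%:E = \int[cmu]_(t in (I : set L)) (k1 t)%:E)%E.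
Proof. exact: (mp_integral mp mk1 k10). Qed.

(** Transported by [sg], [k1] is at most the derivative of [G \o phi]. Equality of the integrals
    gives [G (phi1 1) <= G (phi 1)], and [G] is strictly increasing because [m] is positive. *)
Lemma calibration_le :
  (forall y u, I y -> x0 <= u ->
    phi1 y `^ (1 - p1 y) * m (phi1 y) <= u `^ (1 - p1 y) * m u) ->
  phi1 1 <= phi 1.
Proof.
move=> H; have [G dG] := antiderivative cm.
have x0' := x00.
have dG' u : x0 <= u -> derivable G u 1 /\ derive1 G u = m u.
  by move=> xu; apply: dG; lra.
have [C HC] := continuous_bounded_itv x0 (phi 1) cm m0.
have [C1 HC1] := continuous_bounded_itv x0 (phi1 1) cm m0.
have /le_trans le1 : ((G (phi1 1) - G (phi1 0))%:E <= \int[cmu]_(t in (I : set L)) (k1 t)%:E)%E.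
  apply: (@ode_comp_le_integral R p1 f1 phi1 x0 p11 x00 sol1 G m C1) => //.
  by apply: aeW => t It _; exact: lexx.
have : (\int[cmu]_(t in (I : set L)) (k t)%:E <= (G (phi 1) - G (phi 0))%:E)%E.
  apply: (@ode_comp_integral_le R p f phi x0 p_ge1 x00 sol G m C) => //.
  apply: aeW => t It _; rewrite kE// -mulrA ler_wpM2l ?ode_coef_ge0 ?p_ge1//.
  rewrite pE//; apply: H; [exact: mp_in|exact: (ode_ge sol)].
rewrite int_k => /le1; rewrite lee_fin.
have -> : phi1 0 = x0 by case: sol1.
have -> : phi 0 = x0 by case: sol.
rewrite lerD2r => GG; rewrite leNgt; apply/negP => lt.
have /lt_le_trans := antiderivative_lt (lt_le_trans x00 (ode_ge sol unit_itv1)) lt dG m0.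
by move/(_ _ GG); rewrite ltxx.
Qed.

Lemma calibration_ge :
  (forall y u, I y -> x0 <= u ->
    u `^ (1 - p1 y) * m u <= phi1 y `^ (1 - p1 y) * m (phi1 y)) ->
  phi 1 <= phi1 1.
Proof.
move=> H; have [G dG] := antiderivative cm.
have x0' := x00.
have dG' u : x0 <= u -> derivable G u 1 /\ derive1 G u = m u.
  by move=> xu; apply: dG; lra.
have [C HC] := continuous_bounded_itv x0 (phi 1) cm m0.
have [C1 HC1] := continuous_bounded_itv x0 (phi1 1) cm m0.
have /le_trans le1 : ((G (phi 1) - G (phi 0))%:E <= \int[cmu]_(t in (I : set L)) (k t)%:E)%E.
  apply: (@ode_comp_le_integral R p f phi x0 p_ge1 x00 sol G m C) => //.
  apply: aeW => t It _; rewrite kE// -mulrA ler_wpM2l ?ode_coef_ge0 ?p_ge1//.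
  rewrite pE//; apply: H; [exact: mp_in|exact: (ode_ge sol)].
have : (\int[cmu]_(t in (I : set L)) (k1 t)%:E <= (G (phi1 1) - G (phi1 0))%:E)%E.
  apply: (@ode_comp_integral_le R p1 f1 phi1 x0 p11 x00 sol1 G m C1) => //.
  by apply: aeW => t It _; exact: lexx.
rewrite -int_k => /le1; rewrite lee_fin.
have -> : phi1 0 = x0 by case: sol1.
have -> : phi 0 = x0 by case: sol.
rewrite lerD2r => GG; rewrite leNgt; apply/negP => lt.
have /lt_le_trans := antiderivative_lt (lt_le_trans x00 (ode_ge sol1 unit_itv1)) lt dG m0.
by move/(_ _ GG); rewrite ltxx.
Qed.

End Calibration.

Section MonotoneExponent.
Variables (p f sg p1 f1 phi phi1 : R -> R) (x0 : R).
Hypotheses (mp : measure_preserving_transform sg)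
  (m_p1 : lebesgue_measurable_fun p1) (m_f1 : lebesgue_measurable_fun f1)
  (p11 : forall t, I t -> 1 <= p1 t)
  (pE : forall t, I t -> p t = p1 (sg t)) (fE : forall t, I t -> f t = f1 (sg t))
  (x00 : 0 < x0) (sol : ode_solution p f x0 phi) (sol1 : ode_solution p1 f1 x0 phi1).

Let psi t := ln (phi1 t).

Let psi_mon : {in I &, {homo psi : s t / s <= t}}.
Proof.
move=> s t; rewrite !inE => Is It st; have [_ mon _ _] := sol1.
have ps := lt_le_trans x00 (ode_ge sol1 Is); have pt := lt_le_trans x00 (ode_ge sol1 It).
by rewrite /psi ler_ln ?posrE//; apply: mon; rewrite ?inE.
Qed.

(** The maximum with [x0] keeps the logarithm away from 0, so the weight is continuous everywhere;
    it changes nothing on the range of the solutions. *)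
Let cont_exp (M : R -> R) : continuous M ->
  continuous (fun u => expR (M (ln (Num.max u x0)))).
Proof.
move=> cM u.
have mx : 0 < Num.max u x0 by rewrite lt_max x00 orbT.
apply: (@continuous_comp _ _ _ (fun u => M (ln (Num.max u x0))) expR); last exact: continuous_expR.
apply: (@continuous_comp _ _ _ (fun u => ln (Num.max u x0)) M); last exact: cM.
apply: (@continuous_comp _ _ _ (fun u => Num.max u x0) (@ln R)); last exact: continuous_ln.
by apply: continuous_max; [exact: cvg_id|exact: cvg_cst].
Qed.

Let powR_exp (M : R -> R) s u : x0 <= u ->
  u `^ s * expR (M (ln (Num.max u x0))) = expR (s * ln u + M (ln u)).
Proof.
move=> xu; have u0 : 0 < u by exact: lt_le_trans xu.
by rewrite /powR gt_eqF// (max_idPl xu) expRD.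
Qed.

(** In logarithmic form the calibration inequality is exactly the subgradient inequality with slope
    [p1 y - 1] between [ln (phi1 y)] and [ln u]. *)
Lemma increasing_exponent_le : {in I &, {homo p1 : s t / s <= t}} -> phi1 1 <= phi 1.
Proof.
move=> p1_mon.
have [|M [cM HM]] := @convex_primitive R (fun t => p1 t - 1) psi _ psi_mon.
  by move=> s t Is It st; rewrite lerD2r; exact: p1_mon.
apply: (calibration_le mp m_p1 m_f1 p11 pE fE x00 sol sol1 (cont_exp cM)).
  by move=> u; exact: expR_gt0.
move=> y u Iy xu; have xy := ode_ge sol1 Iy.
rewrite !powR_exp// ler_expR.
have := HM y (ln u) Iy; rewrite /psi; have -> : phi1 0 = x0 by case: sol1.
rewrite ler_ln ?posrE// ?(lt_le_trans x00 xu)// => /(_ xu).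
lra.
Qed.

(** Now [1 - p1] is the nondecreasing slope, so [- M] takes the place of [M] and the minimum becomes
    a maximum. *)
Lemma decreasing_exponent_ge : {in I &, {homo p1 : s t / s <= t >-> t <= s}} -> phi 1 <= phi1 1.
Proof.
move=> p1_mon.
have [|M [cM HM]] := @convex_primitive R (fun t => 1 - p1 t) psi _ psi_mon.
  by move=> s t Is It st; rewrite lerD2l lerN2; exact: p1_mon.
have cM' : continuous (fun v => - M v) by move=> v; apply: cvgN; exact: cM.
apply: (calibration_ge mp m_p1 m_f1 p11 pE fE x00 sol sol1 (cont_exp cM')).
  by move=> u; exact: expR_gt0.
move=> y u Iy xu; have xy := ode_ge sol1 Iy.
rewrite !(powR_exp (fun v => - M v))// ler_expR.
have := HM y (ln u) Iy; rewrite /psi; have -> : phi1 0 = x0 by case: sol1.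
rewrite ler_ln ?posrE// ?(lt_le_trans x00 xu)// => /(_ xu).
lra.
Qed.

End MonotoneExponent.
End Monotone.

(** * The constant [b_const] and the passage to the norms *)

Section NormComparison.
Context {R : realType}.
Local Notation mu := (@lebesgue_measure R).
Local Notation I := (`[0, 1]%classic : set R).

Lemma ln_le_tangent (x y : R) : 0 < x -> 0 < y -> ln x <= ln y + (x / y - 1).
Proof.
move=> x0 y0; have xy : 0 < x / y by rewrite divr_gt0.
have := expR_ge1Dx (ln (x / y)); rewrite lnK ?posrE// ln_div ?posrE//; lra.
Qed.

(* Jensen for ln at the points y^-1 and 1, with weights y and 1 - y. *)
Lemma mul_ln_le (y : R) : 0 < y -> y < 1 -> y * ln (y^-1) <= ln (2 - y).
Proof.
move=> y0 y1; have A0 : 0 < 2 - y by lra.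
have yV0 : 0 < y^-1 by rewrite invr_gt0.
have /(ler_wpM2l (ltW y0)) h1 := ln_le_tangent yV0 A0.
have h2 : 0 <= (1 - y) * (ln (2 - y) + (1 / (2 - y) - 1)).
  rewrite mulr_ge0//; first by lra.
  by rewrite -(@ln1 R); apply: ln_le_tangent.
(* The tangent corrections cancel because [2 - y] is the weighted mean of the two points. *)
have e : y * (y^-1 / (2 - y) - 1) + (1 - y) * (1 / (2 - y) - 1) = 0.
  by field; rewrite !gt_eqF.
have := h1; have := h2; move: e; rewrite !mulrDr; lra.
Qed.

(** A solution exists by the intermediate value theorem, so [xget] does not return its default. The
    bound is then shown for any solution [b], hence for the chosen one. *)
Lemma b_const_ge (r : R) : 1 <= r -> 2 - r^-1 <= b_const r%:E.
Proof.
move=> r1; rewrite /b_const; case: eqVneq => [->|rN1]; first by rewrite invr1; lra.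
have r1' : 1 < r by rewrite lt_neqAle eq_sym rN1.
have r0 : 0 < r by lra.
have rV : 0 < r^-1 by rewrite invr_gt0.
have rV1 : r^-1 < 1 by rewrite invf_lt1.
have ex : exists b : R, 1 < b < 2 /\ b + b `^ (- r) = 2.
  pose c := 2 - r^-1; have c1 : 1 < c by rewrite /c; lra.
  have c2 : c < 2 by rewrite /c; lra.
  have cont : {within `[c, 2], continuous (fun b : R => b + b `^ (- r))}.
    apply: derivable_within_continuous => z; rewrite in_itv/= => /andP[cz _].
    apply: derivableD; first exact: derivable_id.
    apply: derivable_powR; rewrite in_itv/= andbT; lra.
  (* After taking logarithms this is [mul_ln_le] at [r^-1]. *)
  have gc : c + c `^ (- r) <= 2.
    suff : c `^ (- r) <= r^-1 by rewrite /c; lra.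
    rewrite powRN lef_pV2 ?posrE ?powR_gt0//; last by lra.
    rewrite -ler_ln ?posrE ?powR_gt0//; last by lra.
    rewrite ln_powR -ler_pdivrMl//.
    by have := mul_ln_le rV rV1; rewrite invrK.
  have g2 : 2 < 2 + 2 `^ (- r) :> R by rewrite ltrDl powR_gt0.
  have [|b b01 gb] := @IVT R _ c 2 2 (ltW c2) cont.
    by rewrite ge_min gc /= le_max (ltW g2) orbT.
  exists b; move: b01; rewrite in_itv/= => /andP[cb b2]; split => //.
  rewrite (lt_le_trans c1 cb) /= lt_neqAle b2 andbT; apply/eqP => b2'.
  by move: g2; rewrite -{2 3}b2' gb ltxx.
have [/andP[b1 b2] be] := xgetPex 0 ex.
move: (xget _ _) b1 b2 be => b b1 b2 be.
have b0 : 0 < b by lra.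
rewrite leNgt; apply/negP => br.
(* If [b < 2 - r^-1] then [r * y > 1], whereas [mul_ln_le] at [y] reads [y * (r * ln b) <= ln b]. *)
pose y := 2 - b.
have y0 : 0 < y by rewrite /y; lra.
have y1 : y < 1 by rewrite /y; lra.
have yE : y = b `^ (- r) by rewrite /y; lra.
have lny : ln (y^-1) = r * ln b.
  by rewrite lnV ?posrE// yE ln_powR mulNr opprK.
have lnb : 0 < ln b by rewrite ln_gt0.
have := mul_ln_le y0 y1; rewrite lny.
have -> : 2 - y = b by rewrite /y; lra.
rewrite leNgt => /negP; apply.
rewrite mulrA ltr_pMl//.
have : r^-1 < y by rewrite /y; lra.
by rewrite -[r^-1 < y](ltr_pM2r r0) mulVf ?gt_eqF.
Qed.

(** Provides a point with [1 <= p t <= q], which forces [q >= 1] and excludes the value -oo. *)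
Lemma ae01_exists (P : R -> Prop) : {ae mu, forall t, I t -> P t} ->
  exists2 t, I t & P t.
Proof.
move=> H; apply: contrapT => nP.
have : mu.-negligible I.
  apply: negligibleS H => t It /= h; apply: nP; exists t => //; exact: h.
move=> /negligibleP -/(_ (measurable_itv _))/=.
rewrite lebesgue_measure_itv/= lte_fin ltr01 -EFinB subr0 => -[] /eqP.
by rewrite oner_eq0.
Qed.

Lemma ess_sup01_ae (p : R -> R) :
  {ae mu, forall t, I t -> ((p t)%:E <= ess_sup01 p)%E}.
Proof.
have := ess_sup_ge mu (patch (cst -oo%E) I (EFin \o p)).
by apply: (@filterS _ _ (ae_filter_ringOfSetsType mu)) => t + It; rewrite /patch mem_set.
Qed.

Lemma ode_phiP (p f : R -> R) x0 : L_ODE p f -> 0 < x0 ->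
  ode_solution p f x0 (ode_phi p f x0).
Proof. by move=> [_ ex _ _] x00; exact: xgetPex (ex x0 x00). Qed.

Lemma ode_norm_le (p f p2 f2 : R -> R) (c : R) : L_ODE p f -> L_ODE p2 f2 ->
  (forall x0, 0 < x0 -> ode_phi p2 f2 x0 1 <= c * ode_phi p f x0 1) ->
  ode_norm p2 f2 <= c * ode_norm p f.
Proof.
move=> [_ _ cv _] [_ _ cv2 _] H.
have c1 := cv _ unit_itv1; have c2 := cv2 _ unit_itv1.
apply: (ler_cvg_to c2 (cvgM (cvg_cst c) c1)).
by near=> x0; apply: H; near: x0; exact: nbhs_right_gt.
Unshelve. all: by end_near. Qed.

(** Any a.e. bound [q] is allowed in place of the essential supremum, so that both inequalities of
    the theorem can use the same constant. *)
Lemma ode_norm_rearrangement (p f p2 f2 sg : R -> R) :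
  measure_preserving_transform sg ->
  lebesgue_measurable_fun p -> (forall t, I t -> 1 <= p t) ->
  (forall t, I t -> p2 t = p (sg t)) -> (forall t, I t -> f2 t = f (sg t)) ->
  L_ODE p f -> L_ODE p2 f2 -> forall q,
  {ae mu, forall t, I t -> ((p t)%:E <= q)%E} ->
  ode_norm p2 f2 <= b_const q * ode_norm p f.
Proof.
move=> mp m_p p1 p2E f2E fL f2L q pq.
have m_f : lebesgue_measurable_fun f by case: fL.
apply: ode_norm_le => // x0 x00.
have sol := ode_phiP fL x00; have sol2 := ode_phiP f2L x00.
have [t It] := ae01_exists pq.
case: q pq => [r||] pq //= ptr.
  have r1 : 1 <= r by apply: le_trans (p1 _ It) _; rewrite -lee_fin.
  apply: le_trans (_ : (2 - r^-1) * ode_phi p f x0 1 <= _).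
    apply: (rearrangement_le_bounded mp m_p m_f p1 p2E f2E x00 sol sol2 erefl r1).
    exact: pq.
  apply: ler_wpM2r; last exact: b_const_ge.
  exact: ltW (lt_le_trans x00 (ode_ge sol unit_itv1)).
exact: (rearrangement_le2 mp m_p m_f p1 p2E f2E x00 sol sol2 erefl).
Qed.

End NormComparison.

Theorem theorem3p1 (R : realType) (p pi f : R -> R)
  (p_meas : lebesgue_measurable_fun p)
  (p_ge1 : forall t : R, t \in `[0, 1] -> 1 <= p t)
  (pi_mp : measure_preserving_transform pi)
  (f_L : L_ODE p f)
  (fpi_L : L_ODE (p \o inv01 pi) (f \o inv01 pi)) :
  ((b_const (ess_sup01 p))^-1 * ode_norm p f
     <= ode_norm (p \o inv01 pi) (f \o inv01 pi)
     <= b_const (ess_sup01 p) * ode_norm p f) /\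
  (forall pi1 pi2 : R -> R,
     measure_preserving_transform pi1 ->
     measure_preserving_transform pi2 ->
     L_ODE (p \o inv01 pi1) (f \o inv01 pi1) ->
     L_ODE (p \o inv01 pi2) (f \o inv01 pi2) ->
     {in `[0, 1]%classic &, {homo p \o inv01 pi1 : s t / s <= t}} ->
     {in `[0, 1]%classic &, {homo p \o inv01 pi2 : s t / s <= t >-> t <= s}} ->
     ode_norm (p \o inv01 pi1) (f \o inv01 pi1)
       <= ode_norm p f
       <= ode_norm (p \o inv01 pi2) (f \o inv01 pi2)).
Proof.
have p1 (t : R) : (`[0, 1]%classic : set R) t -> 1 <= p t by exact: p_ge1.
have inv1 (s : R -> R) (s_mp : measure_preserving_transform s) t :
    (`[0, 1]%classic : set R) t -> 1 <= (p \o inv01 s) t.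
  by move=> It; apply: p1; exact: inv01_in.
have invm (s : R -> R) (s_mp : measure_preserving_transform s) :
    lebesgue_measurable_fun (p \o inv01 s).
  exact: (mp_measurable_fun (mp_inv01 s_mp) p_meas).
have invE (s g : R -> R) (s_mp : measure_preserving_transform s) t :
    (`[0, 1]%classic : set R) t -> g t = (g \o inv01 s) (s t).
  by move=> It; rewrite /= inv01KV.
have pq := ess_sup01_ae p.
split.
  have b0 : 0 < b_const (ess_sup01 p).
    have [t It] := ae01_exists pq; case: (ess_sup01 p) => [r||] //=.
    rewrite lee_fin => ptr; have r1 : 1 <= r := le_trans (p1 _ It) ptr.
    have := b_const_ge r1; apply: lt_le_trans.
    have : r^-1 <= 1 by rewrite invf_le1//; lra.
    lra.
  apply/andP; split.
    (* The roles are exchanged: [f] is the rearrangement by [pi] of [f \o inv01 pi], and the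
       essential bound on [p] is transported to [p \o inv01 pi]. *)
    rewrite ler_pdivrMl//.
    apply: (ode_norm_rearrangement pi_mp (invm _ pi_mp) (inv1 _ pi_mp)
      (invE _ _ pi_mp) (invE _ _ pi_mp)) => //.
    exact: (mp_ae (mp_inv01 pi_mp) pq).
  exact: (ode_norm_rearrangement (mp_inv01 pi_mp) p_meas p1).
move=> pi1 pi2 mp1 mp2 L1 L2 mon1 mon2; apply/andP; split; rewrite -[leRHS]mul1r.
  (* The sorted pair is the source here, and [p], [f] are recovered from it by composing with
     [pi1]. *)
  apply: ode_norm_le => // x0 x00; rewrite mul1r.
  apply: (increasing_exponent_le mp1 (invm _ mp1) _ (inv1 _ mp1) (invE _ _ mp1)
    (invE _ _ mp1) x00 (ode_phiP f_L x00) (ode_phiP L1 x00) mon1).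
  by case: L1.
apply: ode_norm_le => // x0 x00; rewrite mul1r.
apply: (decreasing_exponent_ge mp2 (invm _ mp2) _ (inv1 _ mp2) (invE _ _ mp2)
  (invE _ _ mp2) x00 (ode_phiP f_L x00) (ode_phiP L2 x00) mon2).
by case: L2.
Qed.
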